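(* Let $\mathcal{T}$ be the class of all tame FDZ-algebras. Then any $R$ from $\mathcal{T}$ is finitely axiomatizable inside the class of all FDZ-algebras; that is, for every $R\in\mathcal{T}$ there is a sentence $\phi_R$ of $L$ such that $R\models\phi_R$ and for every FDZ-algebra $S$, $S\models\phi_R$ if and only if $S\cong R$.
   Context: A ring is an abelian group equipped with a $\mathbb{Z}$-bilinear binary operation (not necessarily associative, commutative or unital). An FDZ-algebra is a ring whose additive group is finitely generated as an abelian group. $L$ is the first-order language of pure rings, with signature $\langle+,\cdot,0\rangle$. For a ring $R$: $Ann(R)=\{x\in R: xy=yx=0\ \text{for all } y\in R\}$; $R^2$ is the ideal of $R$ generated by all products $xy$, $x,y\in R$; for an ideal $I$, $Is(I)=\{x\in R: ax\in I\text{ for some }a\in\mathbb{Z}\setminus\{0\}\}$. An FDZ-algebra $R$ is called tame if $Ann(R)\subseteq Is(R^2)$. *)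

(* Defs.v *)
From HB Require Import structures.
From mathcomp Require Import all_boot all_order all_algebra.

Set Implicit Arguments.
Unset Strict Implicit.
Unset Printing Implicit Defensive.

Import GRing.Theory.
Local Open Scope ring_scope.

(* Rings in the wide sense (not necessarily associative, commutative or       *)
(* unital), which MathComp's ring structures do not cover. For maps between   *)
(* abelian groups, Z-bilinearity is the same as distributivity on both sides. *)
HB.mixin Record Zmodule_isNARing R of GRing.Zmodule R := {
  namul : R -> R -> R;
  namulDl : left_distributive namul +%R;
  namulDr : right_distributive namul +%R
}.

#[short(type="naRingType")]
HB.structure Definition NARing := { R of Zmodule_isNARing R & GRing.Zmodule R }.

Notation "x ** y" := (namul x y) (at level 40, left associativity) : ring_scope.

Definition fdz_algebra (R : naRingType) : Prop :=
  exists (m : nat) (s : m.-tuple R), forall x : R, inIntSpan s x.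

Definition annihilator (R : naRingType) (x : R) : Prop :=
  forall y : R, x ** y = 0 /\ y ** x = 0.

Definition is_ideal (R : naRingType) (I : R -> Prop) : Prop :=
  [/\ I 0,
      forall x y, I x -> I y -> I (x - y),
      forall a x, I x -> I (a ** x)
    & forall a x, I x -> I (x ** a)].

Definition ideal_generated (R : naRingType) (X : R -> Prop) (x : R) : Prop :=
  forall I : R -> Prop, is_ideal I -> (forall y, X y -> I y) -> I x.

Definition ring_square (R : naRingType) : R -> Prop :=
  ideal_generated (fun z : R => exists x y : R, z = x ** y).

Definition isolator (R : naRingType) (I : R -> Prop) (x : R) : Prop :=
  exists2 a : int, a != 0 & I (x *~ a).

Definition tame (R : naRingType) : Prop :=
  forall x : R, annihilator x -> isolator (@ring_square R) x.

Definition na_isomorphic (R S : naRingType) : Prop :=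
  exists f : {additive R -> S},
    bijective f /\ forall x y : R, f (x ** y) = f x ** f y.

(* First-order logic with equality over the signature <+, *, 0>. Variables    *)
(* are named by natural numbers.                                              *)
Inductive term : Type :=
  | Var of nat
  | Zero
  | Add of term & term
  | Mul of term & term.

Inductive formula : Type :=
  | Eq of term & term
  | Not of formula
  | And of formula & formula
  | Or of formula & formula
  | Implies of formula & formula
  | Forall of nat & formula
  | Exists of nat & formula.

Fixpoint term_vars (t : term) : seq nat :=
  match t with
  | Var n => [:: n]
  | Zero => [::]
  | Add t1 t2 | Mul t1 t2 => term_vars t1 ++ term_vars t2
  end.

Fixpoint free_vars (phi : formula) : seq nat :=
  match phi with
  | Eq t1 t2 => term_vars t1 ++ term_vars t2
  | Not p => free_vars p
  | And p q | Or p q | Implies p q => free_vars p ++ free_vars q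
  | Forall n p | Exists n p => [seq k <- free_vars p | k != n]
  end.

Definition sentence (phi : formula) : Prop := free_vars phi = [::].

Fixpoint eval (R : naRingType) (e : nat -> R) (t : term) : R :=
  match t with
  | Var n => e n
  | Zero => 0
  | Add t1 t2 => eval e t1 + eval e t2
  | Mul t1 t2 => eval e t1 ** eval e t2
  end.

Fixpoint sat (R : naRingType) (e : nat -> R) (phi : formula) : Prop :=
  match phi with
  | Eq t1 t2 => eval e t1 = eval e t2
  | Not p => ~ sat e p
  | And p q => sat e p /\ sat e q
  | Or p q => sat e p \/ sat e q
  | Implies p q => sat e p -> sat e q
  | Forall n p => forall x : R, sat [eta e with n |-> x] p
  | Exists n p => exists x : R, sat [eta e with n |-> x] p
  end.

(* For a sentence, satisfaction does not depend on the assignment. *)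
Definition models (R : naRingType) (phi : formula) : Prop :=
  forall e : nat -> R, sat e phi.

(* Main.v *)
From HB Require Import structures.
From mathcomp Require Import all_boot all_order all_algebra.
From mathcomp Require Import boolp.
From mathcomp Require Import ring zify.
Require Import Defs.

Set Implicit Arguments.
Unset Strict Implicit.
Unset Printing Implicit Defensive.

Import Order.TTheory GRing.Theory Num.Theory.
Local Open Scope ring_scope.

(** Let b_1, ..., b_m generate the additive group of R. The sentence says that
    some x_1, ..., x_m satisfy the finitely many additive relations and the
    multiplication table of the b_i, so that b_i |-> x_i extends to a
    homomorphism f from R to S, and then forces f to be bijective. The difficulty
    is surjectivity: a formula cannot quantify over the integer coefficients of
    combinations of the x_i, and finitely many congruences only make the index of f(R) in S
    finite and prime to a chosen integer n.

    The substitute for integers is the ring of scalars of R, that is the maps al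
    with al(a) b = a al(b) and (ab = cd implies al(a) b = al(c) d). Modulo Ann(R)
    they are additive, they commute ([scalar_mulC]) and they are determined by
    their values on the b_i, so a scalar is coded by an m-tuple of elements and
    its action is definable from that code ([code_scalar], [scalar_code]).

    Filter R, starting at Ann(R), by subgroups stable under the scalars, such that
    each step adds the scalar multiples of one element x whose annihilator modulo
    the previous subgroup is a prime ideal of scalars; such an x exists as
    subgroups of finitely generated abelian groups satisfy the ascending chain
    condition ([prime_element], [captured_all]). A subgroup is called captured
    when it is definable by a formula which, under a suitable axiom, defines in
    every S a subgroup contained in f(R) + Ann(S). If x is torsion modulo the
    previous subgroup, the step has finite index and nothing is to be done
    ([captured_finite]). Otherwise the step is an order in a number field: a
    commutative domain whose additive group has finite rank. Its multiplication is
    definable, so an axiom can say that the corresponding quotient in S carries a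
    biadditive product without zero divisors, into which f maps compatibly and
    onto modulo n ([captured_order]).

    This forces f to be onto this quotient ([image_saturated]). Let l be a prime
    that does not divide n and let y be outside the image, with l y = f(z). Powers
    of y have bounded denominators, hence some power of z is divisible by l. But
    the order is reduced modulo every prime that does not divide the determinant
    of its trace form ([reduced_modulo_primes]), so if n is a multiple of this
    determinant, z is divisible by l, and y is in the image after all.

    Once all of R is captured, S = f(R) + Ann(S). Therefore all products of S lie
    in f(R), and so does Ann(S): since R is tame, Ann(R) lies in finitely many
    cosets of the group of sums of m products ([tame_representatives]), and the
    sentence can say the same of Ann(S). Injectivity of f, needed at every step
    and at the end, is controlled by congruences ([injectivity_axiom]). *)

(** * Identities in abelian groups *)

(** Reflection for equations between integer combinations of elements of an
    abelian group: two combinations are equal as soon as the coefficients of each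
    atom agree, and these are equations in [int]. *)
Inductive zexpr : Type :=
  | ZVar of nat
  | ZZero
  | ZAdd of zexpr & zexpr
  | ZOpp of zexpr
  | ZMul of zexpr & int.

Fixpoint zeval (V : zmodType) (env : seq V) (t : zexpr) : V :=
  match t with
  | ZVar n => env`_n
  | ZZero => 0
  | ZAdd t1 t2 => zeval env t1 + zeval env t2
  | ZOpp t1 => - zeval env t1
  | ZMul t1 k => zeval env t1 *~ k
  end.

Fixpoint zcoef (t : zexpr) (i : nat) : int :=
  match t with
  | ZVar n => if eqn n i then 1 else 0
  | ZZero => 0
  | ZAdd t1 t2 => zcoef t1 i + zcoef t2 i
  | ZOpp t1 => - zcoef t1 i
  | ZMul t1 k => zcoef t1 i * k
  end.

Fixpoint zcoef_eq (n : nat) (t1 t2 : zexpr) : Prop :=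
  if n is n'.+1 then zcoef t1 n' = zcoef t2 n' /\ zcoef_eq n' t1 t2 else True.

Lemma zeval_coef (V : zmodType) (env : seq V) t :
  zeval env t = \sum_(i < size env) env`_i *~ zcoef t i.
Proof.
elim: t => [n||t1 IH1 t2 IH2|t IH|t IH k] /=.
- have [lt_n|le_n] := ltnP n (size env); last first.
    rewrite nth_default // big1 // => i _; case: eqnP => [ni|_]; last by rewrite mulr0z.
    by have := ltn_ord i; rewrite -ni ltnNge le_n.
  rewrite (bigD1 (Ordinal lt_n)) //= (introT eqnP erefl) mulr1z.
  rewrite big1 ?addr0 // => i; rewrite -val_eqE /= eq_sym => ni.
  by case: eqnP ni => [->|_]; rewrite ?eqxx ?mulr0z.
- by rewrite big1 // => i _; rewrite mulr0z.
- by rewrite IH1 IH2 -big_split; apply: eq_bigr => i _; rewrite mulrzDr.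
- by rewrite IH -sumrN; apply: eq_bigr => i _; rewrite mulrNz.
- rewrite IH mulrz_suml; apply: eq_bigr => i _; by rewrite mulrzA.
Qed.

Lemma zmod_eq (V : zmodType) (env : seq V) t1 t2 :
  zcoef_eq (size env) t1 t2 -> zeval env t1 = zeval env t2.
Proof.
move=> eq12; rewrite !zeval_coef; apply: eq_bigr => i _; congr (_ *~ _).
elim: (size env) (nat_of_ord i) (ltn_ord i) eq12 => // n IH k.
by rewrite ltnS leq_eqVlt => /orP[/eqP -> []//|lt_k [_]]; exact: IH.
Qed.

(** Atoms are compared up to conversion because the same sum can occur with
    syntactically different structure instances. *)
Ltac zindex x env :=
  match env with
  | ?y :: _ => let _ := match goal with _ => unify x y end in constr:(O)
  | _ :: ?env' => let n := zindex x env' in constr:(S n)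
  end.
Ltac zmember x env :=
  match env with
  | ?y :: _ => let _ := match goal with _ => unify x y end in constr:(true)
  | _ :: ?env' => zmember x env'
  | _ => constr:(false)
  end.
Ltac zatoms t env :=
  lazymatch t with
  | (?a + ?b)%R => let env1 := zatoms a env in zatoms b env1
  | (- ?a)%R => zatoms a env
  | (?a *~ ?k)%R => zatoms a env
  | (?a *+ ?k)%R => zatoms a env
  | 0%R => env
  | _ => lazymatch zmember t env with
         | true => env
         | false => constr:(t :: env)
         end
  end.
Ltac zreify t env :=
  lazymatch t with
  | (?a + ?b)%R => let a' := zreify a env in let b' := zreify b env in
                   constr:(ZAdd a' b')
  | (- ?a)%R => let a' := zreify a env in constr:(ZOpp a')
  | (?a *~ ?k)%R => let a' := zreify a env in constr:(ZMul a' k)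
  | (?a *+ ?k)%R => let a' := zreify a env in constr:(ZMul a' (Posz k))
  | 0%R => constr:(ZZero)
  | _ => let n := zindex t env in constr:(ZVar n)
  end.
Ltac zmod :=
  lazymatch goal with
  | |- @eq ?T ?a ?b =>
      let env := zatoms a (@nil T) in
      let env := zatoms b env in
      let a' := zreify a env in
      let b' := zreify b env in
      refine (@zmod_eq _ env a' b' _);
      cbn [size zcoef_eq zcoef eqn]; repeat split; ring
  end.

(** * First-order definability *)

(** The variables of a family are indexed by an arbitrary type, so that a
    quantifier is the passage from [option I] (or a sum type) to [I] and formulas
    need not be written with named variables. *)
Definition family (I : Type) : Type := forall S : naRingType, (I -> S) -> Prop.

(** Quantifying over all namings [rho] of the variables builds renaming into the
    definition; the bound [k] on the names provides fresh ones for quantifiers.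
    One formula serves all rings [S]. *)
Definition definable (I : Type) (P : family I) : Prop :=
  forall (k : nat) (rho : I -> nat), (forall i, rho i < k)%N ->
  exists phi : formula,
    (forall j, j \in free_vars phi -> exists i, j = rho i) /\
    forall (S : naRingType) (e : nat -> S) (v : I -> S),
      (forall i, v i = e (rho i)) -> (sat e phi <-> P S v).

Lemma fo_iff I (P Q : family I) :
  (forall S v, P S v <-> Q S v) -> definable P -> definable Q.
Proof.
move=> PQ foP k rho lt_rho; have [phi [fv sat_phi]] := foP k rho lt_rho.
by exists phi; split=> // S e v ev; rewrite -PQ; apply: sat_phi.
Qed.

Lemma fo_rename I J (sigma : I -> J) (P : family I) :
  definable P -> definable (fun S (v : J -> S) => P S (fun i => v (sigma i))).
Proof.
move=> foP k rho lt_rho.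
have [phi [fv sat_phi]] := foP k (fun i => rho (sigma i)) (fun i => lt_rho _).
exists phi; split=> [j /fv[i ->]|S e v ev]; first by exists (sigma i).
exact: sat_phi.
Qed.

Lemma fo_not I (P : family I) : definable P -> definable (fun S v => ~ P S v).
Proof.
move=> foP k rho lt_rho; have [phi [fv sat_phi]] := foP k rho lt_rho.
exists (Not phi); split=> // S e v ev /=.
by rewrite (sat_phi S e v ev).
Qed.

Lemma fo_and I (P Q : family I) :
  definable P -> definable Q -> definable (fun S v => P S v /\ Q S v).
Proof.
move=> foP foQ k rho lt_rho.
have [phi [fvp sat_p]] := foP k rho lt_rho.
have [psi [fvq sat_q]] := foQ k rho lt_rho.
exists (And phi psi); split=> [j /=|S e v ev /=].
  by rewrite mem_cat => /orP[/fvp|/fvq].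
by rewrite (sat_p S e v ev) (sat_q S e v ev).
Qed.

Lemma fo_and3 I (P1 P2 P3 : family I) : definable P1 -> definable P2 -> definable P3 ->
  definable (fun S v => [/\ P1 S v, P2 S v & P3 S v]).
Proof.
move=> fo1 fo2 fo3; apply: fo_iff (fo_and fo1 (fo_and fo2 fo3)) => S v.
by split=> [[? []]|[]].
Qed.

Lemma fo_and5 I (P1 P2 P3 P4 P5 : family I) :
  definable P1 -> definable P2 -> definable P3 -> definable P4 -> definable P5 ->
  definable (fun S v => [/\ P1 S v, P2 S v, P3 S v, P4 S v & P5 S v]).
Proof.
move=> fo1 fo2 fo3 fo4 fo5.
apply: fo_iff (fo_and3 fo1 fo2 (fo_and3 fo3 fo4 fo5)) => S v.
by split=> [[? ? []]|[]].
Qed.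

Lemma fo_or I (P Q : family I) :
  definable P -> definable Q -> definable (fun S v => P S v \/ Q S v).
Proof.
move=> foP foQ; have := fo_not (fo_and (fo_not foP) (fo_not foQ)).
by apply: fo_iff => S v; rewrite not_andE !not_notE.
Qed.

Lemma fo_imp I (P Q : family I) :
  definable P -> definable Q -> definable (fun S v => P S v -> Q S v).
Proof.
move=> foP foQ; have := fo_or (fo_not foP) foQ.
by apply: fo_iff => S v; rewrite implyE.
Qed.

Lemma fo_ex I (P : forall S : naRingType, (I -> S) -> S -> Prop) :
  definable (fun S (w : option I -> S) => P S (fun i => w (Some i)) (w None)) ->
  definable (fun S (v : I -> S) => exists y, P S v y).
Proof.
move=> foP k rho lt_rho.
pose rho' o := if o is Some i then rho i else k.
have lt_rho' o : (rho' o < k.+1)%N.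
  by case: o => [i|] /=; [apply: ltnW; rewrite ltnS|].
have [phi [fv sat_phi]] := foP _ _ lt_rho'.
exists (Exists k phi); split=> [j /=|S e v ev /=].
  rewrite mem_filter => /andP[jk /fv[[i|] /= ej]]; first by exists i.
  by rewrite ej eqxx in jk.
suff E y : sat [eta e with k |-> y] phi <-> P S v y.
  by split=> -[y Hy]; exists y; apply/E.
apply: (sat_phi S _ (fun o => if o is Some i then v i else y)) => -[i|] /=.
  by rewrite ltn_eqF ?lt_rho.
by rewrite eqxx.
Qed.

Lemma fo_all I (P : forall S : naRingType, (I -> S) -> S -> Prop) :
  definable (fun S (w : option I -> S) => P S (fun i => w (Some i)) (w None)) ->
  definable (fun S (v : I -> S) => forall y, P S v y).
Proof.
move=> foP.
have := fo_not (@fo_ex I (fun S v y => ~ P S v y) (fo_not foP)).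
apply: fo_iff => S v; split=> [noP y|allP [y]]; last by apply.
by apply: contrapT => nPy; apply: noP; exists y.
Qed.

Fixpoint exists_block (k m : nat) (phi : formula) : formula :=
  if m is m'.+1 then Exists k (exists_block k.+1 m' phi) else phi.

Lemma free_vars_exists_block k m phi j :
  j \in free_vars (exists_block k m phi) ->
  j \in free_vars phi /\ ~~ (k <= j < k + m)%N.
Proof.
elim: m k => [|m IH] k /=; first by rewrite addn0; case: leqP => //= /ltnW ->.
rewrite mem_filter => /andP[jk /IH[-> nj]]; split=> //.
by rewrite leq_eqVlt eq_sym (negPf jk) /= addnS -addSn.
Qed.

Lemma sat_ext (S : naRingType) (e e' : nat -> S) phi :
  e =1 e' -> (sat e phi <-> sat e' phi).
Proof.
have ev_ext t (e1 e2 : nat -> S) : e1 =1 e2 -> eval e1 t = eval e2 t.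
  move=> E; elim: t => [n||t1 IH1 t2 IH2|t1 IH1 t2 IH2] //=.
    by rewrite IH1 IH2.
  by rewrite IH1 IH2.
have upd (e1 e2 : nat -> S) n x :
    e1 =1 e2 -> [eta e1 with n |-> x] =1 [eta e2 with n |-> x].
  by move=> E k /=; case: eqP.
elim: phi e e' => [t1 t2|p IH|p IHp q IHq|p IHp q IHq|p IHp q IHq|n p IH|n p IH]
  e e' E /=.
- by rewrite !(ev_ext _ _ _ E).
- by rewrite (IH _ _ E).
- by rewrite (IHp _ _ E) (IHq _ _ E).
- by rewrite (IHp _ _ E) (IHq _ _ E).
- by rewrite (IHp _ _ E) (IHq _ _ E).
- by split=> H x; apply/(IH _ _ (upd _ _ n x E)).
- by split=> -[x H]; exists x; apply/(IH _ _ (upd _ _ n x E)).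
Qed.

Lemma sat_exists_block (S : naRingType) (e : nat -> S) k m phi :
  sat e (exists_block k m phi) <->
  exists2 e', (forall j, ~~ (k <= j < k + m)%N -> e' j = e j) & sat e' phi.
Proof.
elim: m k e => [|m IH] k e /=.
  split=> [H|[e' E H]]; first by exists e.
  by apply/(@sat_ext _ _ e') => // j; rewrite E // addn0; case: leqP => //= /ltnW ->.
split=> [[y /IH[e' E H]]|[e' E H]].
  exists e' => // j nj; rewrite E /=; last first.
    by apply: contra nj => /andP[/ltnW -> /=]; rewrite addSnnS.
  by case: eqP nj => // ->; rewrite leqnn -addSnnS leq_addr.
exists (e' k); apply/IH; exists e' => // j nj /=; case: eqP => [->//|/eqP jk].
by apply: E; rewrite leq_eqVlt eq_sym (negPf jk) /= -addSnnS.
Qed.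

Lemma fo_ex_block I (m : nat)
    (P : forall S : naRingType, (I -> S) -> ('I_m -> S) -> Prop) :
  definable (fun S (w : I + 'I_m -> S) =>
        P S (fun i => w (inl i)) (fun j => w (inr j))) ->
  definable (fun S (v : I -> S) => exists u, P S v u).
Proof.
move=> foP k rho lt_rho.
pose rho' (s : I + 'I_m) := match s with inl i => rho i | inr j => (k + j)%N end.
have lt_rho' s : (rho' s < k + m)%N.
  by case: s => [i|j] /=; [exact: leq_trans (lt_rho i) (leq_addr _ _)|rewrite ltn_add2l].
have [phi [fv sat_phi]] := foP _ _ lt_rho'.
exists (exists_block k m phi); split=> [j /free_vars_exists_block[]|S e v ev].
  move=> /fv[[i|i] /= ->]; first by exists i.
  by rewrite leq_addr ltn_add2l ltn_ord.
rewrite sat_exists_block; split=> [[e' E /(sat_phi S e')]|[u Pu]].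
  move=> /(_ (fun s => match s with inl i => v i | inr j => e' (k + j)%N end)).
  move=> H; exists (fun j => e' (k + j)%N); apply: H => -[i|j] //=.
  by rewrite E ?ev // leqNgt lt_rho.
pose e' j := if (k <= j)%N then oapp u (e j) (insub (j - k)%N) else e j.
exists e' => [j|].
  rewrite /e'; case: (leqP k j) => //= le_kj; case: insubP => //= o lt_o _.
  by rewrite -{1}(subnKC le_kj) ltn_add2l lt_o.
apply/(sat_phi S e' (fun s => match s with inl i => v i | inr j => u j end)) => //.
case=> [i|j] /=; rewrite /e'; first by rewrite leqNgt lt_rho.
by rewrite leq_addr addKn insubT //= => lt_j; congr u; apply: val_inj.
Qed.

(** For a proposition that does not depend on the ring, the formula is chosen by
    excluded middle. This lets an axiom depend on facts about a fixed ring R. *)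
Lemma fo_const I (Q : Prop) : definable (fun S (_ : I -> S) => Q).
Proof.
move=> k rho lt_rho.
have T (S : naRingType) (e : nat -> S) : sat e (Eq Zero Zero) by [].
case: (EM Q) => q; [exists (Eq Zero Zero)|exists (Not (Eq Zero Zero))]; split=> //.
by move=> S e v _; split=> // /(_ erefl).
Qed.

Lemma fo_all_in I (T : eqType) (s : seq T) (P : T -> family I) :
  (forall r, r \in s -> definable (P r)) ->
  definable (fun S v => forall r, r \in s -> P r S v).
Proof.
elim: s => [|a s IH] foP; first by apply: fo_iff (fo_const True).
have foa : definable (P a) by apply: foP; rewrite mem_head.
have fos : definable (fun S v => forall r, r \in s -> P r S v).
  by apply: IH => r rs; apply: foP; rewrite in_cons rs orbT.
apply: fo_iff (fo_and foa fos) => S v; split=> [[Pa Ps] r|H].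
  by rewrite in_cons => /predU1P[->|/Ps].
by split=> [|r rs]; apply: H; rewrite in_cons ?eqxx ?rs ?orbT.
Qed.

Lemma fo_ex_in I (T : eqType) (s : seq T) (P : T -> family I) :
  (forall r, r \in s -> definable (P r)) ->
  definable (fun S v => exists2 r, r \in s & P r S v).
Proof.
move=> foP; have := @fo_all_in I T s (fun r S v => ~ P r S v).
move=> /(_ (fun r rs => fo_not (foP r rs))) /fo_not; apply: fo_iff => S v.
split=> [H|[r rs Pr] H]; last exact: H Pr.
by apply: contrapT => nex; apply: H => r rs Pr; apply: nex; exists r.
Qed.

Lemma fo_all_fin I (T : finType) (P : T -> family I) :
  (forall r, definable (P r)) -> definable (fun S v => forall r, P r S v).
Proof.
move=> foP; have := @fo_all_in I T (enum T) P (fun r _ => foP r).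
by apply: fo_iff => S v; split=> H r //; apply: H; rewrite mem_enum.
Qed.

Lemma fo_eq_term I (l : seq I) (t1 t2 : term) :
  forall i0 : I, definable (fun S v =>
    eval (fun j => v (nth i0 l j)) t1 = eval (fun j => v (nth i0 l j)) t2).
Proof.
move=> i0 k rho lt_rho.
pose fix sub t := match t with
  | Var j => Var (rho (nth i0 l j)) | Zero => Zero
  | Add a b => Add (sub a) (sub b) | Mul a b => Mul (sub a) (sub b) end.
have fv t j : j \in term_vars (sub t) -> exists i, j = rho i.
  elim: t => [n||a IHa b IHb|a IHa b IHb] //=.
  - by rewrite inE => /eqP ->; exists (nth i0 l n).
  - by rewrite mem_cat => /orP[].
  - by rewrite mem_cat => /orP[].
exists (Eq (sub t1) (sub t2)); split=> [j /=|S e v ev /=].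
  by rewrite mem_cat => /orP[] /fv.
suff E t : eval e (sub t) = eval (fun j => v (nth i0 l j)) t by rewrite !E.
by elim: t => [n||a IHa b IHb|a IHa b IHb] //=; rewrite ?ev ?IHa ?IHb.
Qed.

(** Going through graphs gives definable expressions that are not terms of the
    language, such as opposites and integer multiples. *)
Definition definable_expr (I : Type) (t : forall S : naRingType, (I -> S) -> S) : Prop :=
  definable (fun S (w : option I -> S) => w None = t S (fun i => w (Some i))).

(** The value of an expression is named by an existential quantifier. *)
Lemma fo_let I (t : forall S : naRingType, (I -> S) -> S)
    (P : forall S : naRingType, (I -> S) -> S -> Prop) :
  definable_expr t ->
  definable (fun S (w : option I -> S) => P S (fun i => w (Some i)) (w None)) ->
  definable (fun S v => P S v (t S v)).
Proof.
move=> fet foP.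
have := @fo_ex I (fun S v y => y = t S v /\ P S v y) (fo_and fet foP).
by apply: fo_iff => S v; split=> [[y [->]]|H] //; exists (t S v).
Qed.

Lemma fo_eq I (t1 t2 : forall S : naRingType, (I -> S) -> S) :
  definable_expr t1 -> definable_expr t2 -> definable (fun S v => t1 S v = t2 S v).
Proof. by move=> fe1 fe2; apply: (fo_let (P := fun S v y => y = t2 S v) fe1). Qed.

Lemma fe_rename I J (sigma : I -> J) (t : forall S : naRingType, (I -> S) -> S) :
  definable_expr t -> definable_expr (fun S (v : J -> S) => t S (fun i => v (sigma i))).
Proof. by move=> /(fo_rename (omap sigma)). Qed.
Arguments fe_rename {I J} sigma {t}.

Lemma fe_var I (i : I) : definable_expr (fun S (v : I -> S) => v i).
Proof.
exact: (fo_eq_term [:: None; Some i] (Var 0) (Var 1) None).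
Qed.

Lemma fe_zero I : definable_expr (fun S (_ : I -> S) => 0).
Proof. exact: (fo_eq_term [:: None] (Var 0) Zero None). Qed.

Lemma fe_let I (t : forall S : naRingType, (I -> S) -> S)
    (g : forall S : naRingType, (I -> S) -> S -> S) :
  definable_expr t ->
  definable_expr (fun S (w : option I -> S) => g S (fun i => w (Some i)) (w None)) ->
  definable_expr (fun S v => g S v (t S v)).
Proof.
move=> fet feg.
pose P (S : naRingType) (w : option I -> S) y :=
  w None = g S (fun i => w (Some i)) y.
apply: (fo_let (P := P) (fe_rename Some fet)).
pose swap (o : option (option I)) := match o with
  None => Some None | Some None => None | Some (Some i) => Some (Some i) end.
exact: fo_rename swap _ feg.
Qed.

Lemma fe_add I (t1 t2 : forall S : naRingType, (I -> S) -> S) :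
  definable_expr t1 -> definable_expr t2 -> definable_expr (fun S v => t1 S v + t2 S v).
Proof.
move=> fe1 fe2; apply: (fe_let (g := fun S v y => y + t2 S v) fe1).
apply: (fe_let (g := fun S w z => w None + z) (fe_rename Some fe2)).
exact: (fo_eq_term [:: None; Some (Some None); Some None]
          (Var 0) (Add (Var 1) (Var 2)) None).
Qed.

Lemma fe_mul I (t1 t2 : forall S : naRingType, (I -> S) -> S) :
  definable_expr t1 -> definable_expr t2 -> definable_expr (fun S v => t1 S v ** t2 S v).
Proof.
move=> fe1 fe2; apply: (fe_let (g := fun S v y => y ** t2 S v) fe1).
apply: (fe_let (g := fun S w z => w None ** z) (fe_rename Some fe2)).
exact: (fo_eq_term [:: None; Some (Some None); Some None]
          (Var 0) (Mul (Var 1) (Var 2)) None).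
Qed.

Lemma fe_opp I (t : forall S : naRingType, (I -> S) -> S) :
  definable_expr t -> definable_expr (fun S v => - t S v).
Proof.
move=> fet; apply: (fe_let (g := fun S v y => - y) fet).
have := fo_eq_term [:: None; Some (@None I)] (Add (Var 0) (Var 1)) Zero None.
apply: fo_iff => S v /=.
by split=> [/eqP|->]; [rewrite addr_eq0 => /eqP|rewrite addNr].
Qed.

Lemma fe_mulz I (t : forall S : naRingType, (I -> S) -> S) (k : int) :
  definable_expr t -> definable_expr (fun S v => t S v *~ k).
Proof.
move=> fet; have feN (n : nat) : definable_expr (fun S v => t S v *+ n).
  elim: n => [|n IH]; first exact: fe_zero.
  by apply: fo_iff (fe_add fet IH) => S v; rewrite mulrS.
by case: k => n; [exact: feN|exact: fe_opp (feN _)].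
Qed.

Lemma fe_sum I (T : finType) (t : T -> forall S : naRingType, (I -> S) -> S) :
  (forall j, definable_expr (t j)) -> definable_expr (fun S v => \sum_j t j S v).
Proof.
move=> fet; suff fes s : definable_expr (fun S v => \sum_(j <- s) t j S v) by exact: fes.
elim: s => [|j s IH]; rewrite /definable_expr.
  by apply: (fo_iff _ (@fe_zero I)) => S v; rewrite big_nil.
by apply: (fo_iff _ (fe_add (fet j) IH)) => S v; rewrite big_cons.
Qed.

Definition definable_unary (I : Type) (H : forall S : naRingType, (I -> S) -> S -> Prop) :=
  definable (fun S (w : option I -> S) => H S (fun i => w (Some i)) (w None)).

Lemma fo_unary I J (H : forall S : naRingType, (I -> S) -> S -> Prop)
    (sigma : I -> J) (t : forall S : naRingType, (J -> S) -> S) :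
  definable_unary H -> definable_expr t ->
  definable (fun S v => H S (fun i => v (sigma i)) (t S v)).
Proof.
move=> foH fet.
apply: (fo_let (P := fun S v y => H S (fun i => v (sigma i)) y) fet).
exact: fo_rename (omap sigma) _ foH.
Qed.

Definition definable_ternary (I : Type)
    (P : forall S : naRingType, (I -> S) -> S -> S -> S -> Prop) :=
  definable (fun S (w : option (option (option I)) -> S) =>
    P S (fun i => w (Some (Some (Some i)))) (w (Some (Some None))) (w (Some None))
      (w None)).

Lemma fo_ternary I J (P : forall S : naRingType, (I -> S) -> S -> S -> S -> Prop)
    (sigma : I -> J) (t1 t2 t3 : forall S : naRingType, (J -> S) -> S) :
  definable_ternary P -> definable_expr t1 -> definable_expr t2 -> definable_expr t3 ->
  definable (fun S v => P S (fun i => v (sigma i)) (t1 S v) (t2 S v) (t3 S v)).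
Proof.
move=> foP fe1 fe2 fe3.
apply: (fo_let (P := fun S v y => P S (fun i => v (sigma i)) y (t2 S v) (t3 S v)) fe1).
apply: (fo_let (P := fun S w y => P S (fun i => w (Some (sigma i))) (w None) y
  (t3 S (fun j => w (Some j)))) (fe_rename Some fe2)).
apply: (fo_let (P := fun S w y => P S (fun i => w (Some (Some (sigma i))))
  (w (Some None)) (w None) y) (fe_rename (fun j => Some (Some j)) fe3)).
exact: fo_rename (omap (omap (omap sigma))) _ foP.
Qed.

(** Closes definability goals by following the shape of the relation; hypotheses
    on the definability of its parameters are used at the leaves. *)
Ltac fo_step := cbv beta; first
  [ apply: fo_and | apply: fo_and3 | apply: fo_and5
  | apply: fo_or | apply: fo_not | apply: fo_imp
  | apply: fo_ex_block | apply: fo_ex | apply: fo_all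
  | apply: fe_var | apply: fe_zero | apply: fe_add
  | apply: fe_opp | apply: fe_mul | apply: fe_mulz | apply: fe_sum => ?
  | apply: fo_all_fin => ? | apply: fo_eq
  | match goal with H : definable_unary _ |- _ => apply: (fo_unary _ H) end
  | match goal with H : definable_ternary _ |- _ => apply: (fo_ternary _ H) end
  | match goal with H : definable _ |- _ => apply: (fo_rename _ H) end ].
Ltac fo_auto := repeat fo_step.

(** * Finitely generated abelian groups *)

Definition subgroup (V : zmodType) (H : V -> Prop) : Prop :=
  H 0 /\ forall x y, H x -> H y -> H (x - y).

Section Subgroup.
Variables (V : zmodType) (H : V -> Prop).
Hypothesis sgH : subgroup H.

Lemma sg0 : H 0. Proof. by case: sgH. Qed.
Lemma sgB x y : H x -> H y -> H (x - y). Proof. by case: sgH => _; apply. Qed.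
Lemma sgN x : H x -> H (- x).
Proof. by move=> Hx; rewrite -sub0r; apply: sgB => //; apply: sg0. Qed.
Lemma sgD x y : H x -> H y -> H (x + y).
Proof. by move=> Hx Hy; rewrite -(opprK y); apply: sgB => //; apply: sgN. Qed.
Lemma sgMn x n : H x -> H (x *+ n).
Proof.
by move=> Hx; elim: n => [|n IH]; [apply: sg0|rewrite mulrS; apply: sgD].
Qed.
Lemma sgMz x (k : int) : H x -> H (x *~ k).
Proof. by case: k => n Hx; [apply: sgMn|apply: sgN; apply: sgMn]. Qed.
Lemma sg_sum (T : Type) (s : seq T) (F : T -> V) :
  (forall j, H (F j)) -> H (\sum_(j <- s) F j).
Proof.
move=> HF; elim: s => [|j s IH]; first by rewrite big_nil; apply: sg0.
by rewrite big_cons; apply: sgD.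
Qed.

Lemma sg_trans y x z : H (x - y) -> H (y - z) -> H (x - z).
Proof. by move=> Hxy Hyz; have := sgD Hxy Hyz; rewrite addrA subrK. Qed.
Lemma sg_sym x y : H (x - y) -> H (y - x).
Proof. by move=> Hxy; rewrite -opprB; apply: sgN. Qed.
Lemma sg_congr x y : H (x - y) -> H y -> H x.
Proof. by move=> Hxy Hy; rewrite -(subrK y x); apply: sgD. Qed.
Lemma sg_congrr x y : H (x - y) -> H x -> H y.
Proof. by move=> /sg_sym; apply: sg_congr. Qed.
Lemma sg_subMz x y (k : int) : H (x - y) -> H (x *~ k - y *~ k).
Proof. by move=> Hxy; rewrite -mulrzBl; apply: sgMz. Qed.
Lemma sg_subsum (T : Type) (s : seq T) (F G : T -> V) :
  (forall j, H (F j - G j)) -> H (\sum_(j <- s) F j - \sum_(j <- s) G j).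
Proof. by move=> HFG; rewrite -sumrB; apply: sg_sum. Qed.

Lemma sg_coprime x (k l : int) :
  coprimez k l -> H (x *~ k) -> H (x *~ l) -> H x.
Proof.
move=> /coprimezP[[u v] /= uv] Hk Hl; rewrite -(mulr1z x) -uv mulrzDr.
by apply: sgD; rewrite mulrC mulrzA; apply: sgMz.
Qed.

End Subgroup.

(** Peeling off one generator at a time makes inductions on the number of
    generators structural. *)
Fixpoint span (V : zmodType) (s : seq V) (x : V) : Prop :=
  if s is a :: s' then exists k : int, span s' (x - a *~ k) else x = 0.

Section Span.
Variable V : zmodType.
Implicit Types (s : seq V) (H L : V -> Prop).

Lemma sg_span s : subgroup (span s).
Proof.
elim: s => [|a s [IH0 IHB]] /=; first by split=> // x y -> ->; rewrite subr0.
split=> [|x y [k Hx] [l Hy]]; first by exists 0; rewrite mulr0z subr0.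
exists (k - l); have := IHB _ _ Hx Hy.
suff -> : x - a *~ k - (y - a *~ l) = x - y - a *~ (k - l) by [].
by zmod.
Qed.

Lemma span_tail a s x : span s x -> span (a :: s) x.
Proof. by exists 0; rewrite mulr0z subr0. Qed.

Lemma span_mem s a : a \in s -> span s a.
Proof.
elim: s => //= b s IH; rewrite inE => /predU1P[->|/IH]; last exact: span_tail.
by exists 1; rewrite mulr1z subrr; apply: (sg0 (sg_span s)).
Qed.

Lemma span_min H s : subgroup H -> (forall a, a \in s -> H a) ->
  forall x, span s x -> H x.
Proof.
move=> sgH; elim: s => [|a s IH] Hs x /=; first by move=> ->; apply: sg0.
move=> [k Hx]; rewrite -(subrK (a *~ k) x); apply: (sgD sgH).
  by apply: IH Hx => b bs; apply: Hs; rewrite inE bs orbT.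
by apply: (sgMz sgH); apply: Hs; rewrite mem_head.
Qed.

Lemma least_nat (P : nat -> Prop) :
  (exists n, P n) -> exists2 n, P n & forall k, P k -> (n <= k)%N.
Proof.
move=> [n Pn]; have exP : exists n, `[<P n>] by exists n; apply/asboolP.
case: (ex_minnP exP) => m /asboolP Pm min_m; exists m => // k Pk.
by apply: min_m; apply/asboolP.
Qed.

(** The ascending chain condition in the form of maximal elements. For generators
    a :: s, the integers k such that some element of H is k a modulo the span of s
    form an ideal; take H in the family for which this ideal is largest (its
    positive generator g is least), and among those H one with maximal
    intersection with the span of s. *)
Lemma subgroup_noetherian s (F : (V -> Prop) -> Prop) :
  (forall H, F H -> subgroup H /\ forall x, H x -> span s x) ->
  (exists H, F H) ->
  exists2 H, F H & forall H', F H' -> (forall x, H x -> H' x) ->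
                   forall x, H' x -> H x.
Proof.
elim: s F => [|a s IH] F Fs [H0 FH0].
  exists H0 => // H' FH' _ x; have [_ sub'] := Fs _ FH'.
  by move=> /sub' ->; case: (Fs _ FH0) => -[].
pose J H k := exists2 x, H x & span s (x - a *~ k).
have [[g]|noJ] := EM (exists g : nat, (0 < g)%N /\ exists2 H, F H & J H g).
  move=> Jg; have [{Jg}g [g_gt0 [H1 FH1 JH1]] min_g] :=
    @least_nat (fun g : nat => (0 < g)%N /\ exists2 H, F H & J H g) (ex_intro _ g Jg).
  (* Only those H whose ideal of leading coefficients contains the least g. *)
  pose F' K := exists2 H, F H /\ J H g & K = (fun x => H x /\ span s x).
  have [||K [H [FH JH] ->] maxK] := IH F'.
  - move=> K [H [FH _] ->]; have [sgH _] := Fs _ FH.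
    split=> [|x []//]; split=> [|x y [Hx sx] [Hy sy]].
      by split; [apply: sg0|apply: sg0 (sg_span s)].
    by split; [apply: sgB|apply: (sgB (sg_span s))].
  - by eexists; exists H1.
  exists H => // H' FH' HH' x H'x.
  have [sgH subH] := Fs _ FH; have [sgH' subH'] := Fs _ FH'.
  have [h Hh sh] := JH; have [k sk] := subH' _ H'x.
  pose y := x - h *~ (k %/ g)%Z.
  have H'y : H' y by apply: (sgB sgH') => //; apply: (sgMz sgH'); apply: HH'.
  have sy : span s (y - a *~ (k %% g)%Z).
    have := sgB (sg_span s) sk (sgMz (sg_span s) (k %/ g)%Z sh).
    suff -> : x - a *~ k - (h - a *~ g) *~ (k %/ g)%Z = y - a *~ (k %% g)%Z by [].
    by rewrite {1}(divz_eq k g) /y; zmod.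
  have gz : g%:Z != 0 by rewrite eqz_nat -lt0n.
  have r0 : (k %% g)%Z = 0.
    have [r Er] : exists r : nat, (k %% g)%Z = r.
      by exists `|(k %% g)%Z|%N; rewrite gez0_abs // modz_ge0.
    apply/eqP; rewrite Er; apply: contraT => r_neq0.
    have /min_g : (0 < r)%N /\ exists2 H, F H & J H r.
      by split; [rewrite lt0n|exists H' => //; exists y => //; rewrite -Er].
    by rewrite leqNgt -ltz_nat -Er ltz_pmod // ltz_nat.
  rewrite r0 mulr0z subr0 in sy.
  have F'H' : F' (fun x => H' x /\ span s x).
    by exists H' => //; split=> //; exists h => //; apply: HH'.
  have [Hy _] : H y /\ span s y.
    by apply: (maxK _ F'H') => [z [Hz sz]|]; split=> //; apply: HH'.
  by rewrite -(subrK (h *~ (k %/ g)%Z) x); apply: (sgD sgH) => //; apply: (sgMz sgH).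
apply: IH; last by exists H0.
move=> H FH; have [sgH subH] := Fs _ FH; split=> // x Hx; have [k sk] := subH x Hx.
suff k0 : k = 0 by rewrite k0 mulr0z subr0 in sk.
apply/eqP; apply: contraT => k_neq0; case: noJ; exists `|k|%N.
split; first by rewrite absz_gt0.
exists H => //; case: (ger0P k) => k0; first by exists x => //; rewrite gez0_abs.
exists (- x); first exact: sgN.
rewrite ltz0_abs // mulrNz -opprD; exact: (sgN (sg_span s)).
Qed.

(** A maximal finitely generated subgroup of H is H. *)
Lemma subgroup_fg s H : subgroup H -> (forall x, H x -> span s x) ->
  exists s', forall x, H x <-> span s' x.
Proof.
move=> sgH Hs.
pose F K := exists2 s', forall a, a \in s' -> H a & K = span s'.
have [||K [s' Hs' ->] max] := subgroup_noetherian (s := s) (F := F).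
- move=> K [s' Hs' ->]; split=> [|x /(span_min sgH Hs')/Hs //]; exact: sg_span.
- by exists (span [::]), [::].
exists s' => x; split=> [Hx|]; last exact: span_min.
have Fx : F (span (x :: s')).
  by exists (x :: s') => // a; rewrite inE => /predU1P[->|/Hs'].
by apply: (max _ Fx) => [z|]; [exact: span_tail|apply: span_mem; rewrite mem_head].
Qed.

(** A finitely generated torsion group is finite: the representatives are the
    combinations of the generators with coefficients below their orders. *)
Lemma finite_representatives s L : subgroup L ->
  (forall a, a \in s -> exists2 k : int, k != 0 & L (a *~ k)) ->
  exists2 l : seq V, forall r, r \in l -> span s r &
    forall x, span s x -> exists2 r, r \in l & L (x - r).
Proof.
move=> sgL; elim: s => [|a s IH] tors.
  exists [:: 0] => [r|x ->]; first by rewrite inE => /eqP ->.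
  by exists 0; rewrite ?inE // subrr; apply: sg0.
have [k k_neq0 Lak] := tors a (mem_head _ _).
have [|l sl repl] := IH; first by move=> b bs; apply: tors; rewrite inE bs orbT.
exists [seq r + a *+ c | r <- l, c <- iota 0 `|k|].
  move=> _ /allpairsP[[r c] /= [rl _ ->]]; exists c%:Z.
  by rewrite -pmulrn addrK; apply: sl.
move=> x [n sx]; have [r rl Lr] := repl _ sx.
exists (r + a *+ `|(n %% k)%Z|).
  apply/allpairsP; exists (r, `|(n %% k)%Z|%N); split=> //=.
  rewrite mem_iota /= add0n -ltz_nat gez0_abs ?modz_ge0 //.
  by apply: ltz_mod.
rewrite pmulrn gez0_abs ?modz_ge0 //.
apply: (sg_congr sgL) Lr.
have -> : x - (r + a *~ (n %% k)%Z) - (x - a *~ n - r) = a *~ k *~ (n %/ k)%Z.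
  by rewrite {2}(divz_eq n k); zmod.
exact: sgMz.
Qed.

Lemma representatives_modulo_multiple s H L (n : int) : subgroup H -> subgroup L ->
  n != 0 -> (forall a, H a <-> span s a) ->
  exists2 l : seq V, forall r, r \in l -> H r &
    forall a, H a -> exists2 r, r \in l & exists2 h, H h & L (a - r - h *~ n).
Proof.
move=> sgH sgL n0 sE; pose Ln a := exists2 h, H h & L (a - h *~ n).
have sgLn : subgroup Ln.
  split=> [|a c [g Hg La] [h Hh Lc]].
    by exists 0; [exact: sg0|rewrite mul0rz subr0; exact: sg0].
  exists (g - h); first exact: sgB.
  by have := sgB sgL La Lc; congr L; zmod.
have [|l ls lr] := @finite_representatives s Ln sgLn.
  move=> a /span_mem/sE Ha; exists n => //; exists a => //.
  by rewrite subrr; apply: sg0.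
by exists l => [r /ls/sE //|a /sE/lr].
Qed.

(** Nakayama's lemma for H = L + n H, with H finitely generated modulo L. The usual
    determinant is replaced by an induction on the number of generators: a first
    generator a is moved into L, which gives an integer q = 1 mod n for the
    remaining ones; then a itself is killed by an integer of the form q - k n. *)
Lemma nakayama (n : int) s H L : subgroup L ->
  (forall a, a \in s -> H a) ->
  (forall h, H h -> exists2 l, L l & span s (h - l)) ->
  (forall h, H h -> exists2 h', H h' & L (h - h' *~ n)) ->
  exists2 q : int, exists t, q = 1 + n * t & forall h, H h -> L (h *~ q).
Proof.
elim: s L => [|a s IH] L sgL Hs gen div.
  exists 1; first by exists 0; rewrite mulr0 addr0.
  by move=> h /gen[l Ll /= /eqP]; rewrite subr_eq0 mulr1z => /eqP ->.
pose L' x := exists k : int, L (x - a *~ k).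
have LL' x : L x -> L' x by exists 0; rewrite mulr0z subr0.
have sgL' : subgroup L'.
  split=> [|x y [k Lx] [l Ly]]; first exact: LL' (sg0 sgL).
  exists (k - l); suff -> : x - y - a *~ (k - l) = x - a *~ k - (y - a *~ l).
    exact: sgB.
  by zmod.
have [||h Hh|q [t qE] Hq] := IH L' sgL'.
- by move=> b bs; apply: Hs; rewrite inE bs orbT.
- move=> h /gen[l Ll [k sk]]; exists (l + a *~ k); last by rewrite opprD addrA.
  by exists k; rewrite addrK.
- by have [h' Hh' Lh] := div _ Hh; exists h' => //; apply: LL'.
have [h Hh La] := div _ (Hs _ (mem_head _ _)).
have [k Lh] := Hq _ Hh.
have Laq : L (a *~ (q - k * n)).
  have := sgD sgL (sgMz sgL q La) (sgMz sgL n Lh).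
  by congr L; zmod.
exists (q * (q - k * n)) => [|g Hg].
  by exists (t + (t - k) * (1 + n * t)); rewrite qE; ring.
have [l Lg] := Hq _ Hg.
have := sgD sgL (sgMz sgL (q - k * n) Lg) (sgMz sgL l Laq).
by congr L; zmod.
Qed.

Definition comb (e : seq V) (v : nat -> int) : V :=
  \sum_(i < size e) e`_i *~ v i.

Lemma comb_cons a e v : comb (a :: e) v = a *~ v 0%N + comb e (fun i => v i.+1).
Proof. by rewrite /comb big_ord_recl. Qed.

(** A maximal independent family modulo L among the generators; the other ones
    have a multiple in its span. The quotient is thus described by integer
    vectors up to the denominator N, without choosing a basis. *)
Lemma independent_family s L : subgroup L ->
  exists2 e : seq V, {subset e <= s} /\
    (forall v, L (comb e v) -> forall i, (i < size e)%N -> v i = 0) &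
  exists2 N : int, N != 0 & forall x, span s x -> exists v, L (x *~ N - comb e v).
Proof.
move=> sgL; elim: s => [|a s [e [es free_e] [N N0 gen]]].
  exists [::] => //; exists 1 => // x ->; exists (fun => 0).
  by rewrite /comb big_ord0 mul0rz subr0; apply: sg0.
have [[k [k0 [w Lw]]]|indep] := EM (exists k : int, k != 0 /\
    exists w, L (a *~ k - comb e w)).
  exists e; first by split=> // b /es be; rewrite inE be orbT.
  exists (N * k); first by rewrite mulf_neq0.
  move=> x [n sx]; have [v Lv] := gen _ sx.
  exists (fun i => v i * k + w i * (n * N)).
  have -> : comb e (fun i => v i * k + w i * (n * N)) =
            comb e v *~ k + comb e w *~ (n * N).
    rewrite /comb !mulrz_suml -big_split; apply: eq_bigr => i _ /=.
    by rewrite mulrzDr !mulrzA.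
  have := sgD sgL (sgMz sgL k Lv) (sgMz sgL (n * N) Lw).
  by congr L; zmod.
exists (a :: e).
  split=> [b|v]; first by rewrite !inE => /orP[->//|/es ->]; rewrite orbT.
  rewrite comb_cons => Lv; have v0 : v 0%N = 0.
    apply/eqP; apply: contraT => v0; case: indep; exists (v 0%N); split=> //.
    exists (fun i => - v i.+1).
    suff -> : comb e (fun i => - v i.+1) = - comb e (fun i => v i.+1).
      by rewrite opprK.
    by rewrite /comb -sumrN; apply: eq_bigr => i _; rewrite mulrNz.
  by rewrite v0 mulr0z add0r in Lv; case=> // i; apply: free_e Lv i.
exists N => // x [n sx]; have [v Lv] := gen _ sx.
exists (fun i => if i is j.+1 then v j else n * N).
by rewrite comb_cons /= -[fun i => v i]/v; move: Lv; congr L; zmod.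
Qed.
End Span.

(** Codes of scalars and coordinate vectors live in groups of this kind. *)
Lemma span_ffun (m : nat) (V : zmodType) (s : seq V) :
  (forall x, span s x) ->
  exists s' : seq {ffun 'I_m -> V}, forall u, span s' u.
Proof.
move=> gen; pose delta (j : 'I_m) (x : V) : {ffun 'I_m -> V} :=
  [ffun i => if i == j then x else 0].
pose s' := [seq delta j x | j <- enum 'I_m, x <- s]; exists s' => u.
have span_delta j x : span s' (delta j x).
  have sgP : subgroup (fun x => span s' (delta j x)).
    have dB y z : delta j (y - z) = delta j y - delta j z.
      by apply/ffunP => i; rewrite !ffunE; case: eqP; rewrite ?subr0.
    split=> [|y z]; last by rewrite dB; apply: (sgB (sg_span s')).
    by rewrite -(subr0 0) dB subrr; apply: (sg0 (sg_span s')).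
  apply: (span_min sgP) (gen x) => a a_s; apply: span_mem.
  by apply/allpairsP; exists (j, a); rewrite mem_enum.
have -> : u = \sum_j delta j (u j).
  apply/ffunP => i; rewrite sum_ffunE (bigD1 i) //= ffunE eqxx big1 ?addr0 // => j.
  by rewrite ffunE eq_sym => /negPf ->.
exact: (sg_sum (sg_span s')).
Qed.

Lemma uniform_exponent (V : zmodType) (s : seq V) L : subgroup L ->
  (forall a, a \in s -> exists2 k : int, k != 0 & L (a *~ k)) ->
  exists2 M : int, M != 0 & forall a, span s a -> L (a *~ M).
Proof.
move=> sgL; elim: s => [|a s IH] tors.
  by exists 1 => // x ->; rewrite mul0rz; apply: sg0.
have [k k0 Lk] := tors a (mem_head _ _).
have [|M M0 LM] := IH; first by move=> b bs; apply: tors; rewrite inE bs orbT.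
exists (k * M); first by rewrite mulf_neq0.
move=> x [n /LM Lx]; have := sgD sgL (sgMz sgL k Lx) (sgMz sgL (n * M) Lk).
by congr L; zmod.
Qed.

(** * Orders modulo almost all primes *)

(** As X^r - A^r is a multiple of X - A, the characteristic polynomial of A divides
    a power of X, hence is a power of X. *)
Lemma trace_nilpotent (F : fieldType) n (A : 'M[F]_n) r : A ^+ r = 0 -> \tr A = 0.
Proof.
case: n A => [|n] A Ar; first by rewrite /mxtrace big_ord0.
have : char_poly A %| ('X - 0%:P) ^+ (r * n.+1).
  have XA : GRing.comm ('X%:M : 'M[{poly F}]_n.+1) (map_mx polyC A).
    exact: comm_scalar_mx.
  have /(congr1 determinant) := subrXX_comm r XA.
  have -> : map_mx polyC A ^+ r = 0 by rewrite -rmorphXn Ar rmorph0.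
  rewrite subr0 -mulmxE det_mulmx => detE.
  rewrite subr0 exprM; apply/dvdpP; exists (\det (\sum_(i < r)
     'X%:M ^+ (r.-1 - i) * map_mx polyC A ^+ i : 'M[{poly F}]_n.+1)).
  rewrite mulrC -detE.
  have -> : ('X%:M : 'M[{poly F}]_n.+1) ^+ r = ('X^r)%:M by rewrite -rmorphXn.
  by rewrite det_scalar.
move=> /dvdp_exp_XsubCP[k _]; rewrite eqp_monic ?char_poly_monic ?monic_exp ?monicXsubC //.
move=> /eqP charE; have := size_char_poly A; rewrite charE subr0 size_polyXn => -[kE].
have := char_poly_trace A isT; rewrite charE subr0 kE coefXn /= ltn_eqF //.
by move=> /eqP; rewrite eq_sym oppr_eq0 => /eqP.
Qed.

(** The matrices C v are those of the multiplications by the elements v of an order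
    whose additive group is identified with Z^d. The trace form of the order is
    nondegenerate since it is a domain of characteristic 0. If v is nilpotent
    modulo p, so is C v *m M j, hence its trace vanishes modulo p: v is in the
    kernel of the trace form modulo p, which is 0 unless p divides the determinant
    of the form. *)
Section ReducedModulo.
Variables (d : nat) (M : 'I_d -> 'M[int]_d).
Let C (v : 'rV[int]_d) : 'M[int]_d := \sum_i v 0 i *: M i.
Hypotheses (d_gt0 : (0 < d)%N)
  (CM : forall v w, C v *m C w = C (w *m C v))
  (CC : forall v w, C v *m C w = C w *m C v)
  (C_dom : forall v (w : 'rV_d), w *m C v = 0 -> v = 0 \/ w = 0)
  (C_unit : exists w k, k != 0 /\ C w = k%:M).

Let CZ k v : C (k *: v) = k *: C v.
Proof. by rewrite /C scaler_sumr; apply: eq_bigr => i _; rewrite mxE scalerA. Qed.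

Let C_delta i : C (delta_mx 0 i) = M i.
Proof.
rewrite /C (bigD1 i) //= mxE !eqxx scale1r big1 ?addr0 // => j ji.
by rewrite mxE (negPf ji) andbF scale0r.
Qed.

Let gram : 'M[int]_d := \matrix_(i, j) \tr (M i *m M j).

Let mul_gram v j : (v *m gram) 0 j = \tr (C v *m M j).
Proof.
rewrite mxE /C mulmx_suml raddf_sum; apply: eq_bigr => i _ /=.
by rewrite mxE -scalemxAl mxtraceZ.
Qed.

Let det_gram : \det gram != 0.
Proof.
apply/det0P => -[v v0 vG].
have tr0 w : \tr (C v *m C w) = 0.
  rewrite {2}/C mulmx_sumr raddf_sum big1 // => j _ /=.
  by rewrite -scalemxAr mxtraceZ -mul_gram vG mxE mulr0.
have detC : \det (C v) != 0.
  by apply/det0P => -[w w0 /C_dom[] /eqP]; apply/negP.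
have [w0 [k [k0 Ck]]] := C_unit.
(* The vector w0 *m \adj (C v) is an integral multiple of the inverse of v: its
   product with v is det (C v) times w0, whose trace is not 0. *)
have := tr0 (w0 *m \adj (C v)); rewrite CM -mulmxA mul_adj_mx mul_mx_scalar CZ Ck.
rewrite mxtraceZ mxtrace_scalar => /eqP; rewrite !mulf_eq0 (negPf detC) /=.
by rewrite -mulr_natl mulf_eq0 (negPf k0) orbF pnatr_eq0 -leqn0 leqNgt d_gt0.
Qed.

Lemma reduced_modulo_primes : exists2 D : int, D != 0 &
  forall (p : nat), prime p -> ~~ (p %| D)%Z -> forall (v : 'rV_d) r,
    (forall i, (p %| (v *m C v ^+ r)%R 0%R i)%Z) -> forall i, (p %| v 0%R i)%Z.
Proof.
exists (\det gram) => // p p_pr pD v r dvd i.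
have pF := pchar_Fp p_pr.
pose red n m := map_mx (intr : int -> 'F_p) : 'M_(n, m) -> 'M_(n, m).
have redC : red d d (C v) ^+ r.+1 = 0.
  have CX s : C v ^+ s.+1 = C (v *m C v ^+ s).
    elim: s => [|s IH]; first by rewrite expr1 expr0 mulmx1.
    by rewrite exprS {1}IH -mulmxE CM -mulmxA mulmxE -exprSr.
  rewrite -rmorphXn CX; apply/matrixP => a b; rewrite !mxE /C summxE rmorph_sum.
  rewrite big1 // => j _; rewrite mxE rmorphM /=.
  have := dvd j; rewrite (dvdz_pcharf pF) => /eqP ->; exact: mul0r.
have tr0 j : (p %| (v *m gram)%R 0%R j)%Z.
  rewrite (dvdz_pcharf pF) mul_gram -[_%:~R]/(intr _) -trace_map_mx map_mxM.
  apply/eqP/(@trace_nilpotent _ _ _ r.+1); rewrite mulmxE exprMn_comm.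
    by rewrite -/(red d d (C v)) redC mul0r.
  by rewrite /GRing.comm -!mulmxE -!map_mxM -C_delta CC.
have : (p %| (\det gram * v 0 i)%R)%Z.
  have -> : \det gram * v 0 i = (v *m gram *m \adj gram) 0 i.
    by rewrite -mulmxA mul_mx_adj mul_mx_scalar mxE.
  rewrite mxE; apply: (big_ind (fun x => (p %| x)%Z)) => [|x y|j _].
  - exact: dvdz0.
  - exact: rpredD.
  - exact: dvdz_mulr.
rewrite Gauss_dvdzr //; rewrite coprimezE /= prime_coprime //.
Qed.
End ReducedModulo.

(** * Additive maps and products modulo a subgroup *)

Section AdditiveModulo.
Variables (V W : zmodType) (H : V -> Prop) (L : W -> Prop) (g : V -> W).
Hypotheses (sgH : subgroup H) (sgL : subgroup L)
  (gB : forall a b, H a -> H b -> L (g (a - b) - (g a - g b))).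

Lemma modulo0 : L (g 0).
Proof.
have := gB (sg0 sgH) (sg0 sgH).
by rewrite subrr subrr subr0.
Qed.

Lemma moduloD a b : H a -> H b -> L (g (a + b) - (g a + g b)).
Proof.
move=> Ha Hb; have := gB (sgD sgH Ha Hb) Hb; rewrite addrK => /(sgN sgL).
by congr L; zmod.
Qed.

Lemma moduloMn a n : H a -> L (g (a *+ n) - g a *+ n).
Proof.
move=> Ha; elim: n => [|n IH]; first by rewrite !mulr0n subr0; exact: modulo0.
have := sgD sgL (moduloD (sgMn sgH n Ha) Ha) IH.
by rewrite !mulrSr; congr L; zmod.
Qed.

Lemma moduloMz a k : H a -> L (g (a *~ k) - g a *~ k).
Proof.
move=> Ha; case: k => n; first exact: moduloMn.
have := sgD sgL (gB (sg0 sgH) (sgMn sgH n.+1 Ha)) modulo0.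
move=> /(sgD sgL)/(_ (sgN sgL (moduloMn n.+1 Ha))).
by rewrite NegzE !mulrNz -!pmulrn sub0r; congr L; zmod.
Qed.

Lemma modulo_sum (T : Type) (s : seq T) (F : T -> V) : (forall j, H (F j)) ->
  L (g (\sum_(j <- s) F j) - \sum_(j <- s) g (F j)).
Proof.
move=> HF; elim: s => [|j s IH]; first by rewrite !big_nil subr0; exact: modulo0.
rewrite !big_cons; have := sgD sgL (moduloD (HF j) (sg_sum sgH s HF)) IH.
by congr L; zmod.
Qed.

End AdditiveModulo.

Definition lincomb (V : zmodType) d (e : 'I_d -> V) (v : 'rV[int]_d) : V :=
  \sum_i e i *~ v 0 i.

Section LinComb.
Variables (V : zmodType) (d : nat) (e : 'I_d -> V).

Lemma lincombD v w : lincomb e (v + w) = lincomb e v + lincomb e w.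
Proof.
by rewrite -big_split; apply: eq_bigr => i _; rewrite mxE mulrzDr.
Qed.

Lemma lincombZ k v : lincomb e (k *: v) = lincomb e v *~ k.
Proof.
by rewrite /lincomb mulrz_suml; apply: eq_bigr => i _; rewrite mxE mulrC mulrzA.
Qed.

Lemma lincombB v w : lincomb e (v - w) = lincomb e v - lincomb e w.
Proof. by rewrite lincombD -scaleN1r lincombZ mulrN1z. Qed.

Lemma lincomb0 : lincomb e 0 = 0.
Proof. by rewrite /lincomb big1 // => i _; rewrite mxE mulr0z. Qed.

Lemma lincomb_sum (T : Type) (s : seq T) (F : T -> 'rV[int]_d) :
  lincomb e (\sum_(j <- s) F j) = \sum_(j <- s) lincomb e (F j).
Proof.
elim: s => [|j s IH]; first by rewrite !big_nil /lincomb big1 // => i _; rewrite mxE.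
by rewrite !big_cons -IH lincombD.
Qed.

Lemma sg_lincomb (H : V -> Prop) v :
  subgroup H -> (forall i, H (e i)) -> H (lincomb e v).
Proof. by move=> sgH He; apply: (sg_sum sgH) => i; apply: (sgMz sgH). Qed.

End LinComb.

Lemma lincomb_map (V W : zmodType) (f : {additive V -> W}) d (e : 'I_d -> V) v :
  f (lincomb e v) = lincomb (fun i => f (e i)) v.
Proof. by rewrite raddf_sum; apply: eq_bigr => i _; rewrite raddfMz. Qed.

Lemma independent_rows (V : zmodType) (s : seq V) L : subgroup L ->
  exists d (e : 'I_d -> V), [/\ forall i, span s (e i),
    forall v, L (lincomb e v) -> v = 0 &
  exists2 N : int, N != 0 &
    forall x, span s x -> exists v, L (x *~ N - lincomb e v)].
Proof.
move=> sgL; have [e [es free_e] [N N0 gen]] := independent_family s sgL.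
exists (size e), (fun i => e`_i); split=> [i|v Lv|].
- by apply/span_mem/es/mem_nth.
- pose w k := oapp (v 0) 0 (insub k : option 'I_(size e)).
  have wE (i : 'I_(size e)) : w i = v 0 i by rewrite /w valK.
  apply/rowP => i; rewrite mxE -wE; apply: free_e => //.
  by move: Lv; congr L; apply: eq_bigr => j _; rewrite wE.
- exists N => // x /gen[v Lv]; exists (\row_i v i).
  by move: Lv; congr (L (_ - _)); apply: eq_bigr => j _; rewrite mxE.
Qed.

Section ProductModulo.
Variables (W : zmodType) (L0 L1 : W -> Prop) (mu : W -> W -> W).

(** A biadditive product without zero divisors on L1 / L0. Working modulo L0 avoids
    quotient types. *)
Definition product_modulo : Prop :=
  [/\ forall y z, L1 y -> L1 z -> L1 (mu y z),
      forall z, L1 z -> forall y y', L1 y -> L1 y' ->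
        L0 (mu (y - y') z - (mu y z - mu y' z)),
      forall y, L1 y -> forall z z', L1 z -> L1 z' ->
        L0 (mu y (z - z') - (mu y z - mu y z')),
      forall y z, L1 y -> L1 z -> L0 y \/ L0 z -> L0 (mu y z)
    & forall y z, L1 y -> L1 z -> L0 (mu y z) -> L0 y \/ L0 z].

Hypotheses (sgL0 : subgroup L0) (sgL1 : subgroup L1) (mu_prod : product_modulo).

Let muBl z : L1 z -> forall y y', L1 y -> L1 y' ->
  L0 (mu (y - y') z - (mu y z - mu y' z)).
Proof. by case: mu_prod z. Qed.

Let muBr y : L1 y -> forall z z', L1 z -> L1 z' ->
  L0 (mu y (z - z') - (mu y z - mu y z')).
Proof. by case: mu_prod y. Qed.

Lemma product_congr y y' z z' : L1 y -> L1 y' -> L1 z -> L1 z' ->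
  L0 (y - y') -> L0 (z - z') -> L0 (mu y z - mu y' z').
Proof.
move=> Ly Ly' Lz Lz' Lyy' Lzz'; have [_ _ _ mu0 _] := mu_prod.
have A := muBl Lz Ly Ly'.
have B := mu0 _ _ (sgB sgL1 Ly Ly') Lz (or_introl Lyy').
have E := muBr Ly' Lz Lz'.
have F := mu0 _ _ Ly' (sgB sgL1 Lz Lz') (or_intror Lzz').
by have := sgB sgL0 (sgD sgL0 B F) (sgD sgL0 A E); congr L0; zmod.
Qed.

Lemma productMz y z k l : L1 y -> L1 z ->
  L0 (mu (y *~ k) (z *~ l) - mu y z *~ (k * l)).
Proof.
move=> Ly Lz; have Lzl := sgMz sgL1 l Lz.
have A := moduloMz sgL1 sgL0 (muBl Lzl) k Ly.
have B := moduloMz sgL1 sgL0 (muBr Ly) l Lz.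
by have := sgD sgL0 A (sgMz sgL0 k B); congr L0; zmod.
Qed.

Variables (d : nat) (e : 'I_d -> W) (N : int) (M : 'I_d -> 'M[int]_d).
Hypotheses (Le : forall i, L1 (e i))
  (table : forall i j, L0 (mu (e i) (e j) *~ N - lincomb e (row j (M i)))).

(** The multiplication table of the independent family e, with values multiplied
    by N to clear denominators, determines N mu(a, c) for all combinations. *)
Lemma product_lincomb v w :
  L0 (mu (lincomb e v) (lincomb e w) *~ N -
      lincomb e (w *m \sum_i v 0 i *: M i)).
Proof.
have Lw : L1 (lincomb e w) by apply: sg_lincomb.
have step i : L0 (mu (e i) (lincomb e w) *~ N - lincomb e (w *m M i)).
  have -> : w *m M i = \sum_j w 0 j *: row j (M i).
    by apply/rowP => k; rewrite mxE summxE; apply: eq_bigr => j _; rewrite !mxE.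
  rewrite lincomb_sum; have Lej j : L1 (e j *~ w 0 j) by apply: (sgMz sgL1).
  have A := modulo_sum sgL1 sgL0 (muBr (Le i)) (index_enum 'I_d) Lej.
  apply: (sg_trans sgL0 (sg_subMz sgL0 N A)); rewrite mulrz_suml.
  apply: (sg_subsum sgL0) => j.
  have B := moduloMz sgL1 sgL0 (muBr (Le i)) (w 0 j) (Le j).
  apply: (sg_trans sgL0 (sg_subMz sgL0 N B)).
  have := sg_subMz sgL0 (w 0 j) (table i j).
  by rewrite lincombZ; congr L0; zmod.
rewrite mulmx_sumr lincomb_sum.
have Lei i : L1 (e i *~ v 0 i) by apply: (sgMz sgL1).
have A := modulo_sum sgL1 sgL0 (muBl Lw) (index_enum 'I_d) Lei.
apply: (sg_trans sgL0 (sg_subMz sgL0 N A)); rewrite mulrz_suml.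
apply: (sg_subsum sgL0) => i.
have B := moduloMz sgL1 sgL0 (muBl Lw) (v 0 i) (Le i).
apply: (sg_trans sgL0 (sg_subMz sgL0 N B)).
have := sg_subMz sgL0 (v 0 i) (step i).
by rewrite -scalemxAr lincombZ; congr L0; zmod.
Qed.

End ProductModulo.

(** A commutative and associative product with unit x0 on H1 / H0 is described by
    the matrices C v of N times the multiplications. The scaled product with
    matrices C v is again associative, and N x0 acts as N^2, so that the
    reduction result for Z^d applies. *)
Section OrderMatrices.
Variables (V : zmodType) (H0 H1 : V -> Prop) (mu : V -> V -> V) (x0 : V).
Hypotheses (sgH0 : subgroup H0) (sgH1 : subgroup H1)
  (mu_prod : product_modulo H0 H1 mu)
  (muC : forall a c, H1 a -> H1 c -> H0 (mu a c - mu c a))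
  (muA : forall a c r, H1 a -> H1 c -> H1 r ->
     H0 (mu a (mu c r) - mu (mu a c) r))
  (Hx0 : H1 x0) (mu1 : forall a, H1 a -> H0 (mu x0 a - a))
  (x0_free : forall k : int, k != 0 -> ~ H0 (x0 *~ k)).
Variables (d : nat) (e : 'I_d -> V) (N : int) (M : 'I_d -> 'M[int]_d).
Hypotheses (N0 : N != 0) (He : forall i, H1 (e i))
  (e_free : forall v, H0 (lincomb e v) -> v = 0)
  (e_gen : forall a, H1 a -> exists v, H0 (a *~ N - lincomb e v))
  (table : forall i j, H0 (mu (e i) (e j) *~ N - lincomb e (row j (M i)))).
Let C (v : 'rV[int]_d) : 'M[int]_d := \sum_i v 0 i *: M i.
Let mu_H1 a c : H1 a -> H1 c -> H1 (mu a c). Proof. by case: mu_prod a c. Qed.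
Let H1_lin v : H1 (lincomb e v). Proof. exact: sg_lincomb. Qed.
Let mu_C v w : H0 (mu (lincomb e v) (lincomb e w) *~ N - lincomb e (w *m C v)).
Proof. exact: (product_lincomb sgH0 sgH1 mu_prod). Qed.

Let lincomb_inj v w : H0 (lincomb e v - lincomb e w) -> v = w.
Proof. by rewrite -lincombB => /e_free /eqP; rewrite subr_eq0 => /eqP. Qed.

Let mulmx_inj (A B : 'M[int]_d) : (forall u : 'rV_d, u *m A = u *m B) -> A = B.
Proof. by move=> AB; apply/row_matrixP => i; rewrite !rowE AB. Qed.

Let CC v w : w *m C v = v *m C w.
Proof.
apply: lincomb_inj; apply: (sg_trans sgH0 _ (mu_C w v)).
apply: (sg_trans sgH0 (sg_sym sgH0 (mu_C v w))).
by apply: (sg_subMz sgH0); apply: muC.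
Qed.

Let CM v w : C v *m C w = C (w *m C v).
Proof.
apply: mulmx_inj => u; apply: lincomb_inj.
set lu := lincomb e u; set lv := lincomb e v; set lw := lincomb e w.
have [Hu Hv Hw] : [/\ H1 lu, H1 lv & H1 lw] by split; exact: H1_lin.
have [Hvu Hwv] : H1 (mu lv lu) /\ H1 (mu lw lv) by split; apply: mu_H1.
apply: (sg_trans sgH0 (y := mu (mu lw lv) lu *~ (N * N))).
  rewrite mulmxA; apply: (sg_trans sgH0 (sg_sym sgH0 (mu_C w (u *m C v)))).
  rewrite mulrzA; apply: (sg_subMz sgH0).
  have HN := sgMz sgH1 N Hvu.
  apply: (sg_trans sgH0 (y := mu (lw *~ 1) (mu lv lu *~ N))).
    rewrite mulr1z; apply: (product_congr sgH0 sgH1 mu_prod) => //.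
      by rewrite subrr; apply: sg0.
    exact: (sg_sym sgH0 (mu_C v u)).
  apply: (sg_trans sgH0 (productMz sgH0 sgH1 mu_prod 1 N _ Hvu)) => //.
  by rewrite mul1r; apply: (sg_subMz sgH0); apply: muA.
apply: (sg_sym sgH0); apply: (sg_trans sgH0 (sg_sym sgH0 (mu_C (w *m C v) u))).
rewrite mulrzA; apply: (sg_subMz sgH0).
have HN := sgMz sgH1 N Hwv.
apply: (sg_trans sgH0 (y := mu (mu lw lv *~ N) (lu *~ 1))).
  rewrite mulr1z CC; apply: (product_congr sgH0 sgH1 mu_prod) => //.
    exact: (sg_sym sgH0 (mu_C w v)).
  by rewrite subrr; apply: sg0.
by have := productMz sgH0 sgH1 mu_prod N 1 Hwv (H1_lin u); rewrite mulr1.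
Qed.

Lemma order_reduced_modulo_primes : exists2 D : int, D != 0 &
  forall (p : nat), prime p -> ~~ (p %| D)%Z -> forall (v : 'rV_d) r,
    (forall i, (p %| (v *m C v ^+ r)%R 0%R i)%Z) ->
    forall i, (p %| v 0%R i)%Z.
Proof.
have [w0 Hw0] := e_gen Hx0.
apply: reduced_modulo_primes => //.
- rewrite lt0n; apply/eqP => d0; case: (x0_free N0).
  have lin0 : lincomb e w0 = 0.
    by rewrite /lincomb big1 // => i; have := ltn_ord i; rewrite {2}d0.
  by rewrite lin0 subr0 in Hw0.
- by move=> v w; rewrite -!/(C _) !CM CC.
- move=> v w; rewrite -/(C v) => wCv.
  have := mu_C v w; rewrite wCv lincomb0 subr0.
  have [_ _ _ _ dom] := mu_prod.
  move=> HvwN; have Hvw : H1 (mu (lincomb e v) (lincomb e w)) by apply: mu_H1.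
  have HwN := productMz sgH0 sgH1 mu_prod 1 N (H1_lin v) (H1_lin w).
  rewrite mulr1z mul1r in HwN.
  have [|/e_free ->|HN] := dom _ _ (H1_lin v) (sgMz sgH1 N (H1_lin w)).
  + exact: (sg_congr sgH0 HwN).
  + by left.
  + right; have := e_free (v := N *: w); rewrite lincombZ => /(_ HN) /eqP.
    by rewrite scalemx_eq0 (negPf N0) => /eqP.
- exists w0, (N * N); split; first by rewrite mulf_neq0.
  apply: mulmx_inj => u; rewrite -/(C w0) mul_mx_scalar; apply: lincomb_inj.
  rewrite lincombZ mulrzA; apply: (sg_trans sgH0 (sg_sym sgH0 (mu_C w0 u))).
  apply: (sg_subMz sgH0).
  have HN := sgMz sgH1 N Hx0.
  apply: (sg_trans sgH0 (y := mu (x0 *~ N) (lincomb e u *~ 1))).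
    rewrite mulr1z; apply: (product_congr sgH0 sgH1 mu_prod) => //.
      exact: (sg_sym sgH0).
    by rewrite subrr; apply: sg0.
  apply: (sg_trans sgH0 (productMz sgH0 sgH1 mu_prod N 1 Hx0 (H1_lin u))).
  by rewrite mulr1; apply: (sg_subMz sgH0); apply: mu1.
Qed.

End OrderMatrices.

(** * Surjectivity onto an order *)

(** Here H1 / H0 is the order, described by the independent family e up to the
    denominator N and by the matrices of its multiplication table; D is the integer
    outside of whose prime divisors the order is reduced; L1 / L0 is the quotient
    of the other ring, with its product mu. *)
Section Saturation.
Variables (V W : zmodType) (f : {additive V -> W}).
Variables (H0 H1 : V -> Prop) (L0 L1 : W -> Prop).
Hypotheses (sgH1 : subgroup H1) (sgL0 : subgroup L0) (sgL1 : subgroup L1).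
Hypotheses (fH1 : forall a, H1 a -> L1 (f a)) (fH0 : forall a, H0 a -> L0 (f a))
  (f_inj : forall a, H1 a -> L0 (f a) -> H0 a).
Variables (d : nat) (e : 'I_d -> V) (N : int) (M : 'I_d -> 'M[int]_d).
Hypotheses (He : forall i, H1 (e i))
  (e_free : forall v, H0 (lincomb e v) -> v = 0)
  (e_gen : forall a, H1 a -> exists v, H0 (a *~ N - lincomb e v)).
Let C (v : 'rV[int]_d) : 'M[int]_d := \sum_i v 0 i *: M i.
Variable D : int.
Hypothesis reduced : forall p : nat, prime p -> ~~ (p %| D)%Z ->
  forall (v : 'rV[int]_d) r, (forall i, (p %| (v *m C v ^+ r)%R 0%R i)%Z) ->
  forall i, (p %| v 0%R i)%Z.
Variable x0 : V.
Hypotheses (Hx0 : H1 x0) (x0_free : forall k : int, k != 0 -> ~ H0 (x0 *~ k)).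
Variable mu : W -> W -> W.
Hypotheses (mu_prod : product_modulo L0 L1 mu)
  (mu_table : forall i j,
     L0 (mu (f (e i)) (f (e j)) *~ N - f (lincomb e (row j (M i))))).
Variables (sW : seq W) (n : int).
Hypotheses (W_fg : forall y, span sW y)
  (n_gen : forall y, L1 y -> exists2 y', L1 y' &
     exists2 a, H1 a & L0 (y - f a - y' *~ n))
  (n_even : (2 %| n)%Z) (N_n : (N %| n)%Z) (D_n : (D %| n)%Z).

Let L (y : W) : Prop := exists2 a, H1 a & L0 (y - f a).

Let sgL : subgroup L.
Proof.
split=> [|y z [a Ha La] [b Hb Lb]].
  by exists 0; [exact: sg0|rewrite raddf0 subr0; exact: sg0].
exists (a - b); first exact: sgB.
by have := sgB sgL0 La Lb; congr L0; rewrite (raddfB f); zmod.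
Qed.

(** If p t = 0 then t (p f(x0)) = 0, and p f(x0) is not 0 because f is
    injective. *)
Let torsion_free (p : nat) t : (0 < p)%N -> L1 t -> L0 (t *~ p) -> L0 t.
Proof.
move=> p_gt0 Lt Ltp; have Lx := fH1 Hx0.
have p0 : p%:Z != 0 by rewrite eqz_nat -lt0n.
have [_ _ _ mu0 dom] := mu_prod.
have : L0 (mu t (f x0 *~ p)).
  have A := productMz sgL0 sgL1 mu_prod 1 p Lt Lx.
  have B := productMz sgL0 sgL1 mu_prod p 1 Lt Lx.
  have E := mu0 _ _ (sgMz sgL1 p Lt) Lx (or_introl Ltp).
  rewrite !mulr1z mulr1 mul1r in A B.
  by have := sgD sgL0 (sgB sgL0 A B) E; congr L0; zmod.
case/dom => //; first exact: (sgMz sgL1).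
rewrite -(raddfMz f) => /f_inj Hp; case: (x0_free p0).
by apply: Hp; apply: (sgMz sgH1).
Qed.

Let H1_lin v : H1 (lincomb e v). Proof. exact: sg_lincomb. Qed.

Let L1_lin v : L1 (f (lincomb e v)). Proof. exact: fH1. Qed.

Let mu_lincomb v w :
  L0 (mu (f (lincomb e v)) (f (lincomb e w)) *~ N - f (lincomb e (w *m C v))).
Proof.
rewrite !(lincomb_map f); apply: (product_lincomb sgL0 sgL1 mu_prod) => [i|i j].
  exact: fH1.
by rewrite -(lincomb_map f).
Qed.

(** If p y = f(z) then p^(r+1) y^(r+1) = f(z^(r+1)), where powers are iterated
    multiplications by y on the left. As q y^(r+1) is also in the image, z^(r+1)
    is divisible by p for r the exponent of p in q; hence so is z. *)
Let prime_saturated (q p : nat) : (0 < q)%N -> (forall y, L1 y -> L (y *~ q)) ->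
  prime p -> coprimez p n -> forall y, L1 y -> L (y *~ p) -> L y.
Proof.
move=> q0 Lq p_pr p_n y Ly [a Ha Lya].
have p_gt0 := prime_gt0 p_pr.
have p_N : coprimez p N by apply: coprimez_dvdr p_n.
have p_D : ~~ (p %| D)%Z.
  have : coprimez p D by apply: coprimez_dvdr p_n.
  by rewrite coprimezE /= prime_coprime.
have [v Hv] := e_gen Ha.
pose Y := y *~ N; have LY : L1 Y by apply: (sgMz sgL1).
have LYv : L0 (Y *~ p - f (lincomb e v)).
  have := sgD sgL0 (sg_subMz sgL0 N Lya) (fH0 Hv).
  by congr L0; rewrite (raddfB f) (raddfMz f) /Y; zmod.
have [mu_L1 _ _ _ _] := mu_prod.
pose Yp r := iter r (fun z => mu Y z *~ N) Y.
have LYp r : L1 (Yp r) by elim: r => //= r IH; apply: (sgMz sgL1); apply: (mu_L1 _ _ LY).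
have Yp_v r : L0 (Yp r *~ (p ^ r.+1)%N - f (lincomb e (v *m C v ^+ r))).
  elim: r => [|r IH]; first by rewrite expn1 expr0 mulmx1.
  set P := (p ^ r.+1)%N in IH *.
  have -> : v *m C v ^+ r.+1 = v *m C v ^+ r *m C v by rewrite exprSr -mulmxE mulmxA.
  apply: (sg_trans sgL0 _ (mu_lincomb v (v *m C v ^+ r))).
  have LYP : L1 (Yp r *~ P) by apply: (sgMz sgL1).
  have LYY : L1 (Y *~ p) by apply: (sgMz sgL1).
  have A := productMz sgL0 sgL1 mu_prod p P LY (LYp r).
  have E := product_congr sgL0 sgL1 mu_prod LYY (L1_lin v) LYP (L1_lin _) LYv IH.
  have := sgMz sgL0 N (sgB sgL0 E A).
  by rewrite expnS -/P /= PoszM; congr L0; zmod.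
(* The exponent r of p in q is the first one for which q cannot absorb the factor
   p ^ r.+1. *)
have [u p_u qE] := pfactor_coprime p_pr q0.
set r := logn p q in qE.
have [b Hb Lb] := Lq _ (LYp r).
have [w Hw] := e_gen Hb.
set P := (p ^ r.+1)%N in (Yp_v) *.
have rowE : (q%:Z * N) *: (v *m C v ^+ r) = P%:Z *: w.
  apply/eqP; rewrite -subr_eq0; apply/eqP/e_free/f_inj; first exact: H1_lin.
  have A := sg_subMz sgL0 (q%:Z * N) (Yp_v r).
  have B := sg_subMz sgL0 (P%:Z * N) Lb.
  have E := sgMz sgL0 P (fH0 Hw).
  have := sgB sgL0 (sgD sgL0 B E) A.
  by congr L0; rewrite lincombB !lincombZ !(raddfB f) !(raddfMz f) /P; zmod.
have /(reduced p_pr p_D) p_v : forall i, (p %| (v *m C v ^+ r)%R 0%R i)%Z.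
  move=> i; have p_uN : coprimez p (u%:Z * N).
    by rewrite coprimezMr p_N andbT.
  rewrite -(Gauss_dvdzr _ p_uN).
  have pr0 : (p ^ r)%N%:Z != 0 by rewrite eqz_nat -lt0n expn_gt0 p_gt0.
  apply/dvdzP; exists (w 0 i); apply: (mulfI pr0).
  have := congr1 (fun z : 'rV[int]_d => z 0 i) rowE; rewrite mxE [RHS]mxE.
  by rewrite /P expnS qE !PoszM => E; transitivity
    (u%:Z * (p ^ r)%N * N * (v *m C v ^+ r) 0 i); [|rewrite E]; ring.
pose v' : 'rV[int]_d := \row_i (v 0%R i %/ p)%Z.
have vE : v = p%:Z *: v'.
  by apply/rowP => i; rewrite !mxE mulrC divzK // p_v.
have L0Y : L0 (Y - f (lincomb e v')).
  apply: (torsion_free p_gt0); first exact: (sgB sgL1).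
  by move: LYv; rewrite vE lincombZ (raddfMz f); congr L0; zmod.
apply: (sg_coprime sgL p_N); first by exists a.
by exists (lincomb e v').
Qed.

(** By Nakayama's lemma the image has finite index prime to n, and this index can
    be divided by one prime at a time. *)
Lemma image_saturated y : L1 y -> exists2 a, H1 a & L0 (y - f a).
Proof.
rewrite -/(L y); have [sL1 sL1E] := subgroup_fg sgL1 (fun y _ => W_fg y).
have [|||q [t qE] Lq] := @nakayama _ n sL1 L1 L sgL.
- by move=> a /span_mem/sL1E.
- move=> h /sL1E Hh; exists 0; last by rewrite subr0.
  exact: (sg0 sgL).
- move=> h /n_gen[h' Hh' [a Ha Lh]]; exists h' => //; exists a => //.
  by move: Lh; congr L0; zmod.
(* Evenness of n excludes q = 0, which is 1 modulo n when n is 1 or -1. *)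
have q0 : (0 < `|q|)%N.
  rewrite absz_gt0; apply/eqP => qz; move: n_even => /dvdzP[k nE].
  by move: qE; rewrite qz nE; lia.
have {}Lq z : L1 z -> L (z *~ `|q|%N).
  move=> /Lq; rewrite abszE; case: (ger0P q) => // _.
  by rewrite mulrNz => /(sgN sgL).
have q_n : coprimez `|q|%N n.
  have : coprimez q n by apply/coprimezP; exists (1, - t) => /=; rewrite qE; ring.
  by rewrite !coprimezE absz_nat.
have sat m : (0 < m)%N -> coprimez m n -> forall z, L1 z -> L (z *~ m) -> L z.
  elim/ltn_ind: m => m IH m_gt0 m_n z Lz Lzm.
  have [m1|m1] := leqP m 1%N.
    by move: Lzm; have -> : m = 1%N by apply/eqP; rewrite eqn_leq m1.
  have p_pr := pdiv_prime m1; set p := pdiv m in p_pr.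
  have /dvdnP[m' mE] : (p %| m)%N by exact: pdiv_dvd.
  have [p_n m'_n] : coprimez p n /\ coprimez m' n.
    by move: m_n; rewrite mE PoszM coprimezMl => /andP[].
  have m'_gt0 : (0 < m')%N by move: m_gt0; rewrite mE muln_gt0 => /andP[].
  apply: (IH m') => //; first by rewrite mE ltn_Pmulr // prime_gt1.
  apply: (prime_saturated q0 Lq p_pr p_n); first exact: (sgMz sgL1).
  by move: Lzm; rewrite mE PoszM mulrzA.
by move=> Ly; apply: (sat `|q|%N) => //; apply: Lq.
Qed.

End Saturation.

(** * The ring of scalars *)

Section NARingTheory.
Variable R : naRingType.
Implicit Types (a b c : R) (k : int).

Lemma namulBr a b c : a ** (b - c) = a ** b - a ** c.
Proof. by apply/eqP; rewrite -subr_eq opprK -namulDr subrK. Qed.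

Lemma namulBl a b c : (b - c) ** a = b ** a - c ** a.
Proof. by apply/eqP; rewrite -subr_eq opprK -namulDl subrK. Qed.

HB.instance Definition _ a := GRing.isZmodMorphism.Build R R (namul a) (namulBr a).

Definition namul_right a b := b ** a.
HB.instance Definition _ a :=
  GRing.isZmodMorphism.Build R R (namul_right a) (namulBl a).

Lemma namulr0 a : a ** 0 = 0.
Proof. exact: (raddf0 (namul a)). Qed.

Lemma namul0r a : 0 ** a = 0.
Proof. exact: (raddf0 (namul_right a)). Qed.

Lemma namulMzr a b k : a ** (b *~ k) = (a ** b) *~ k.
Proof. exact: (raddfMz (namul a)). Qed.

Lemma namulMzl a b k : (b *~ k) ** a = (b ** a) *~ k.
Proof. exact: (raddfMz (namul_right a)). Qed.

Lemma namul_suml (T : Type) (s : seq T) a (F : T -> R) :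
  (\sum_(i <- s) F i) ** a = \sum_(i <- s) F i ** a.
Proof. exact: (raddf_sum (namul_right a)). Qed.

Lemma sg_annihilator : subgroup (@annihilator R).
Proof.
split=> [y|a b Ha Hb y].
  by rewrite namul0r namulr0.
have [a1 a2] := Ha y; have [b1 b2] := Hb y.
by rewrite namulBl namulBr a1 a2 b1 b2 subrr.
Qed.

(** The largest ring of scalars of the bilinear map R/Ann(R) x R/Ann(R) -> R^2: the
    second condition says that al also acts on products. A scalar is a map on R
    that is meaningful modulo Ann(R) only. *)
Definition is_scalar (al : R -> R) : Prop :=
  (forall a b, al a ** b = a ** al b) /\
  (forall a b c d, a ** b = c ** d -> al a ** b = al c ** d).

Lemma scalar_id : is_scalar id. Proof. by []. Qed.

Lemma scalarD al be : is_scalar al -> is_scalar be -> is_scalar (fun a => al a + be a).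
Proof.
move=> [al1 al2] [be1 be2]; split=> [a b|a b c d E].
  by rewrite namulDl namulDr al1 be1.
by rewrite !namulDl (al2 _ _ _ _ E) (be2 _ _ _ _ E).
Qed.

Lemma scalarMz al k : is_scalar al -> is_scalar (fun a => al a *~ k).
Proof.
move=> [al1 al2]; split=> [a b|a b c d E].
  by rewrite namulMzl namulMzr al1.
by rewrite !namulMzl (al2 _ _ _ _ E).
Qed.

(** Since be(c) d = c be(d), the second condition gives al(be(c)) d =
    al(c) be(d), which is be(al(c)) d. *)
Lemma scalar_mulC al be a b : is_scalar al -> is_scalar be ->
  al (be a) ** b = be (al a) ** b /\ b ** al (be a) = b ** be (al a).
Proof.
move=> [al1 al2] [be1 be2].
have left c d : al (be c) ** d = be (al c) ** d.
  by rewrite (al2 _ _ _ _ (be1 c d)) be1.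
split=> //; rewrite -al1 -be1 -be1 -al1; exact/esym/left.
Qed.

Lemma scalar_comp al be : is_scalar al -> is_scalar be -> is_scalar (fun a => al (be a)).
Proof.
move=> s_al s_be; have [al1 al2] := s_al; have [be1 be2] := s_be.
split=> [a b|a b c d E]; last exact/al2/be2.
by rewrite al1 be1; have [_ ->] := scalar_mulC b a s_al s_be.
Qed.

(** Additivity is a consequence of the first condition. *)
Lemma scalarB al a b : is_scalar al -> annihilator (al (a - b) - (al a - al b)).
Proof.
move=> [al1 _] c; split; first by rewrite !namulBl !al1 namulBl subrr.
by rewrite !namulBr -!al1 namulBr subrr.
Qed.

Lemma scalarC al be a : is_scalar al -> is_scalar be ->
  annihilator (al (be a) - be (al a)).
Proof.
move=> s_al s_be c; rewrite namulBl namulBr.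
by have [-> ->] := scalar_mulC a c s_al s_be; rewrite !subrr.
Qed.

End NARingTheory.

(** * Coordinates with respect to generators *)

Section Coordinates.
Variables (R : naRingType) (m : nat) (b : 'I_m -> R).

Definition evalc (S : naRingType) (x : 'I_m -> S) (c : {ffun 'I_m -> int}) : S :=
  \sum_i x i *~ c i.

Lemma evalcB (S : naRingType) (x : 'I_m -> S) c c' :
  evalc x (c - c') = evalc x c - evalc x c'.
Proof. by rewrite -sumrB; apply: eq_bigr => i _; rewrite !ffunE mulrzBr. Qed.

Lemma evalc_hom (S : naRingType) (f : {additive R -> S}) c :
  evalc (fun i => f (b i)) c = f (evalc b c).
Proof. by rewrite raddf_sum; apply: eq_bigr => i _; rewrite raddfMz. Qed.

Lemma fe_evalc J (sigma : 'I_m -> J) c :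
  definable_expr (fun (S : naRingType) (v : J -> S) => evalc (fun i => v (sigma i)) c).
Proof. by rewrite /evalc; fo_auto. Qed.

Hypothesis b_gen : forall a, exists c, a = evalc b c.

Lemma gen_induction (H : R -> Prop) : subgroup H -> (forall j, H (b j)) ->
  forall a, H a.
Proof.
move=> sgH Hb a; have [c ->] := b_gen a.
by apply: (sg_sum sgH) => i; apply: (sgMz sgH).
Qed.

Definition coord (a : R) : {ffun 'I_m -> int} := projT1 (cid (b_gen a)).
Lemma coordE a : evalc b (coord a) = a.
Proof. by rewrite /coord; case: cid. Qed.

(** The name of a fixed element a of R: the combination of the parameters x that
    gives a when x is b. Axioms about S speak of f(a) through it. *)
Definition point (S : naRingType) (x : 'I_m -> S) (a : R) : S := evalc x (coord a).

Lemma point_hom (S : naRingType) (f : {additive R -> S}) a :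
  point (fun i => f (b i)) a = f a.
Proof. by rewrite /point evalc_hom coordE. Qed.

Lemma point_id a : point b a = a. Proof. exact: coordE. Qed.

Lemma fe_point J (sigma : 'I_m -> J) a :
  definable_expr (fun (S : naRingType) (v : J -> S) => point (fun i => v (sigma i)) a).
Proof. exact: fe_evalc. Qed.

(** * Codes of scalars *)

(** The tuple u stands for the values at x of a scalar al, and a' for al(a): the
    products of al(a) with the x_j are then those of a with the u_j, and they
    determine al(a) modulo the annihilator when x generates. *)
Definition code_act (S : naRingType) (x u : 'I_m -> S) (a a' : S) : Prop :=
  forall j, x j ** a' = u j ** a /\ a' ** x j = a ** u j.

(** Stated for the relation [code_act], the conditions on a scalar quantify over
    elements only, hence are first-order in the code. *)
Definition code (S : naRingType) (x u : 'I_m -> S) : Prop :=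
  [/\ forall a, exists a', code_act x u a a',
      forall a a' c c', code_act x u a a' -> code_act x u c c' ->
        a' ** c = a ** c'
    & forall a a' c c' d d', code_act x u a a' -> code_act x u c c' ->
        a ** d = c ** d' -> a' ** d = c' ** d'].

Lemma code_act_scalar al a : is_scalar al ->
  code_act b (fun j => al (b j)) a (al a).
Proof. by move=> [al1 _] j; rewrite !al1. Qed.

Lemma code_act_uniq u a a1 a2 : code_act b u a a1 -> code_act b u a a2 ->
  annihilator (a1 - a2).
Proof.
move=> act1 act2 c; move: c; apply: gen_induction => [|j].
  split=> [|c d [c1 c2] [d1 d2]].
    by rewrite namul0r namulr0.
  move: (a1 - a2) c1 c2 d1 d2 => z c1 c2 d1 d2.
  by rewrite namulBl namulBr c1 c2 d1 d2 subrr.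
by rewrite namulBl namulBr !(act1 j).1 !(act1 j).2 !(act2 j).1 !(act2 j).2 !subrr.
Qed.

Lemma annihilator_eqr a1 a2 (c : R) : annihilator (a1 - a2) ->
  a1 ** c = a2 ** c /\ c ** a1 = c ** a2.
Proof.
by move=> /(_ c); rewrite namulBl namulBr => -[/eqP + /eqP];
   rewrite !subr_eq0 => /eqP -> /eqP ->.
Qed.

Lemma code_scalar al : is_scalar al -> code b (fun j => al (b j)).
Proof.
move=> s_al; have [al1 al2] := s_al.
have E a a' : code_act b (fun j => al (b j)) a a' -> annihilator (a' - al a).
  by move=> /code_act_uniq; apply; apply: code_act_scalar.
split=> [a|a a' c c' /E aa' /E cc'|a a' c c' d d' /E aa' /E cc' ad].
- by exists (al a); apply: code_act_scalar.
- by rewrite (annihilator_eqr c aa').1 (annihilator_eqr a cc').2.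
- by rewrite (annihilator_eqr d aa').1 (annihilator_eqr d' cc').1; apply: al2.
Qed.

Lemma scalar_code u : code b u ->
  exists2 al, is_scalar al & forall a, code_act b u a (al a).
Proof.
move=> [tot sym comp]; have [al alP] := choice tot.
by exists al => //; split=> [a c|a c d d']; [apply: sym|apply: comp].
Qed.

End Coordinates.

Ltac fo_point := repeat first [apply: fe_point | fo_step].

(** * First-order control of injectivity *)

Lemma fo_subgroup I (H : forall S : naRingType, (I -> S) -> S -> Prop) :
  definable_unary H -> definable (fun S v => subgroup (H S v)).
Proof. by move=> uH; rewrite /subgroup; fo_auto. Qed.

Lemma unary_annihilator I : definable_unary (fun S (_ : I -> S) => @annihilator S).
Proof. by rewrite /definable_unary /annihilator; fo_auto. Qed.

Section Captured.
Variables (R : naRingType) (m : nat) (b : 'I_m -> R).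
Hypothesis b_gen : forall a, exists c, a = evalc b c.
Let pt := point b_gen.

Lemma gens_span : exists s, forall a : R, span s a.
Proof.
exists (codom b) => a; apply: (gen_induction b_gen (sg_span _)) => j.
exact/span_mem/codom_f.
Qed.

Lemma subgroup_of_fg (H : R -> Prop) : subgroup H ->
  exists s, forall a, H a <-> span s a.
Proof. by move=> sgH; have [s sR] := gens_span; apply: (subgroup_fg (s := s)). Qed.

Lemma span_image (S : naRingType) (f : {additive R -> S}) (L : S -> Prop) s :
  subgroup L -> (forall r, r \in s -> L (f r)) -> forall a, span s a -> L (f a).
Proof.
move=> sgL; apply: span_min; split=> [|a c La Lc].
  by rewrite (raddf0 f); apply: sg0.
by rewrite (raddfB f); apply: sgB.
Qed.

(** Let M annihilate the torsion T of H1/H0 and let n = 2 M. The axiom says that n y in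
    H0 implies M y in H0, that f(r) is not in n H1 + H0 for the finitely many r that
    represent H1 modulo n H1 + H0 and are not in it, and that f(r) is not in H0 for
    the finitely many r that represent nonzero elements of T. By the first two
    clauses the kernel K of f on H1/H0 satisfies K = 2 K, so K is torsion by
    Nakayama's lemma, and the third clause gives K = 0. *)
Lemma injectivity_axiom (H0 H1 : forall S : naRingType, ('I_m -> S) -> S -> Prop) :
  definable_unary H0 -> definable_unary H1 -> subgroup (H0 R b) -> subgroup (H1 R b) ->
  (forall a, H0 R b a -> H1 R b a) ->
  exists psi : family 'I_m, [/\ definable psi, psi R b &
    forall (S : naRingType) (f : {additive R -> S}) (fb := fun i => f (b i)),
      psi S fb -> subgroup (H0 S fb) ->
      (forall a, H0 R b a -> H0 S fb (f a)) ->
      (forall a, H1 R b a -> H1 S fb (f a)) ->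
      forall a, H1 R b a -> H0 S fb (f a) -> H0 R b a].
Proof.
move=> u0 u1 sg0R sg1R H01.
pose T a := H1 R b a /\ exists2 k : int, k != 0 & H0 R b (a *~ k).
have sgT : subgroup T.
  split=> [|a c [Ha [k k0 Hk]] [Hc [l l0 Hl]]].
    split; first exact: sg0.
    by exists 1 => //; rewrite mulr1z; apply: sg0.
  split; first exact: sgB.
  exists (k * l); first by rewrite mulf_neq0.
  have := sgB sg0R (sgMz sg0R l Hk) (sgMz sg0R k Hl).
  by congr (H0 R b); zmod.
have [sT sTE] := subgroup_of_fg sgT.
have torsT a : a \in sT -> exists2 k : int, k != 0 & H0 R b (a *~ k).
  by move=> /span_mem/sTE[].
have [M M0 HM] := uniform_exponent sg0R torsT.
have [lT lTs lTr] := finite_representatives sg0R torsT.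
pose n := M * 2.
have n0 : n != 0 by rewrite mulf_neq0.
pose Ln a := exists2 h, H1 R b h & H0 R b (a - h *~ n).
have [s1 s1E] := subgroup_of_fg sg1R.
have [ln _ lnr] := representatives_modulo_multiple sg1R sg0R n0 s1E.
exists (fun S x =>
  [/\ forall y, H1 S x y -> H0 S x (y *~ n) -> H0 S x (y *~ M),
      forall r, r \in ln -> ~ Ln r ->
        ~ exists y, H1 S x y /\ H0 S x (pt x r - y *~ n)
    & forall r, r \in lT -> ~ H0 R b r -> ~ H0 S x (pt x r)]).
split.
- fo_point.
  + by apply: fo_all_in => r _; apply: fo_imp; [exact: fo_const|fo_point].
  + by apply: fo_all_in => r _; apply: fo_imp; [exact: fo_const|fo_point].
- split=> [y Hy Hyn|r _ nLn [y [Hy]]|r _ nH].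
  + by apply/HM/sTE; split=> //; exists n.
  + by rewrite /pt point_id => Hr; apply: nLn; exists y.
  + by rewrite /pt point_id.
move=> S f fb [ax1 ax2 ax3] sgS f0 f1 a Ha H0fa.
pose K c := H1 R b c /\ H0 S fb (f c).
have sgK : subgroup K.
  split=> [|c d [Hc Lc] [Hd Ld]].
    by split; [exact: sg0|rewrite (raddf0 f); exact: sg0].
  by split; [exact: sgB|rewrite (raddfB f); exact: sgB].
have Kdiv c : K c -> exists2 c', K c' & H0 R b (c - c' *~ 2).
  move=> [Hc Lc]; have [r rl [h Hh Lr]] := lnr _ Hc.
  have [h' Hh' Lr'] : Ln r.
    apply: contrapT => /(ax2 r rl); apply; exists (f (- h)).
    split; first by apply/f1/(sgN sg1R).
    rewrite /pt point_hom; have := sgB sgS Lc (f0 _ Lr).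
    by congr (H0 S fb); rewrite !(raddfB f) (raddfMz f) (raddfN f); zmod.
  (* Now c = n g modulo H0, so M g is in K and c = 2 (M g). *)
  pose g := h + h'.
  have Hg : H1 R b g by apply: (sgD sg1R).
  have Lcg : H0 R b (c - g *~ n).
    by have := sgD sg0R Lr Lr'; congr (H0 R b); rewrite /g; zmod.
  exists (g *~ M); last by rewrite -mulrzA.
  split; first exact: (sgMz sg1R).
  rewrite (raddfMz f); apply: ax1; first exact: f1.
  have := sgB sgS Lc (f0 _ Lcg).
  by congr (H0 S fb); rewrite !(raddfB f) !(raddfMz f); zmod.
have [sK sKE] := subgroup_of_fg sgK.
have [|c Kc|q [t qE] Kq] := @nakayama _ 2 sK K (H0 R b) sg0R _ _ Kdiv.
- by move=> c /span_mem/sKE.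
- by exists 0; [exact: sg0|rewrite subr0; apply/sKE].
have /sTE : T a.
  split=> //; exists q; last exact: Kq.
  by apply/eqP => q0; move: qE; rewrite q0; lia.
move=> /lTr[r rl Lar]; apply: (sg_congr sg0R Lar).
apply: contrapT => /(ax3 r rl); apply; rewrite /pt point_hom.
by apply: (sg_congrr sgS _ H0fa); rewrite -(raddfB f); apply: f0.
Qed.

(** * Captured subgroups *)

(** H is defined by a formula with parameters b, and an axiom true in R bounds what
    this formula defines in any other ring, with parameters the images of the
    b_i, by the image of H and the annihilator. *)
Definition captured (H : R -> Prop) : Prop :=
  exists (Hf : forall S : naRingType, ('I_m -> S) -> S -> Prop)
         (psi : family 'I_m),
  [/\ definable_unary Hf, definable psi, forall a, Hf R b a <-> H a, psi R b &
   forall (S : naRingType) (f : {additive R -> S}) (fb := fun i => f (b i)),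
     (exists s, forall y : S, span s y) -> psi S fb ->
     [/\ subgroup (Hf S fb),
         forall a, H a -> Hf S fb (f a)
       & forall y, Hf S fb y -> exists2 a, H a & annihilator (y - f a)]].

Lemma captured_annihilator : captured (@annihilator R).
Proof.
have [s sE] := subgroup_of_fg (sg_annihilator R).
exists (fun S _ => @annihilator S).
exists (fun S x => forall r, r \in s -> annihilator (pt x r)); split=> //.
- exact: unary_annihilator.
- apply: fo_all_in => r _.
  by apply: (fo_unary id (@unary_annihilator 'I_m)); fo_point.
- by move=> r /span_mem/sE; rewrite /pt point_id.
move=> S f fb _ ax; split=> //; first exact: sg_annihilator.
- move=> a /sE; apply: span_image; first exact: sg_annihilator.
  by move=> r /ax; rewrite /pt point_hom.
- move=> y Hy; exists 0; first exact: (sg0 (sg_annihilator R)).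
  by rewrite raddf0 subr0.
Qed.

Lemma captured_finite (H0 H1 : R -> Prop) (l : seq R) :
  captured H0 -> subgroup H0 -> subgroup H1 -> (forall a, H0 a -> H1 a) ->
  (forall r, r \in l -> H1 r) ->
  (forall a, H1 a -> exists2 r, r \in l & H0 (a - r)) -> captured H1.
Proof.
move=> [H0f [psi0 [u0 fo0 H0E psi0R ax0]]] sg0R sg1R H01 lH1 lr.
pose H1f S x y := exists2 r, r \in l & H0f S x (y - pt x r).
have u1 : definable_unary H1f by apply: fo_ex_in => r _; fo_point.
have H1E a : H1f R b a <-> H1 a.
  split=> [[r rl /H0E]|/lr[r rl Hr]]; rewrite /pt ?point_id.
    by move=> /H01 Har; apply: (sg_congr sg1R Har); apply: lH1.
  by exists r => //; rewrite /pt point_id; apply/H0E.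
exists H1f, (fun S x => psi0 S x /\ subgroup (H1f S x)); split=> //.
- by apply: fo_and => //; apply: fo_subgroup.
- by split=> //; split=> [|a c /H1E Ha /H1E Hc]; apply/H1E; [apply: sg0|apply: sgB].
move=> S f fb S_fg [ps0 sg1S]; have [sg0S f0 sub0] := ax0 S f S_fg ps0.
split=> // [a|y [r rl]].
- move=> /lr[r rl Har]; exists r => //.
  by rewrite /pt point_hom -(raddfB f); apply: f0.
- rewrite /pt point_hom => /sub0[a Ha Hy]; exists (a + r).
    by apply: (sgD sg1R); [apply: H01|apply: lH1].
  by move: Hy; congr annihilator; rewrite (raddfD f); zmod.
Qed.

End Captured.

(** * Products as definable relations *)

(** The first-order counterpart of [product_modulo], for a ternary relation in
    place of an operation. *)
Definition product_axioms (V : zmodType) (H0 H1 : V -> Prop)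
    (P : V -> V -> V -> Prop) : Prop :=
  [/\ forall a c, H1 a -> H1 c -> exists r, H1 r /\ P a c r,
      forall a a' c r r' r'', H1 a -> H1 a' -> H1 c ->
        P a c r -> P a' c r' -> P (a - a') c r'' -> H0 (r'' - (r - r')),
      forall a c c' r r' r'', H1 a -> H1 c -> H1 c' ->
        P a c r -> P a c' r' -> P a (c - c') r'' -> H0 (r'' - (r - r')),
      forall a c r, H1 a -> H1 c -> P a c r -> H0 a \/ H0 c -> H0 r
    & forall a c r, H1 a -> H1 c -> P a c r -> H0 r -> H0 a \/ H0 c].

Lemma fo_product_axioms I (H0 H1 : forall S : naRingType, (I -> S) -> S -> Prop)
    (P : forall S : naRingType, (I -> S) -> S -> S -> S -> Prop) :
  definable_unary H0 -> definable_unary H1 -> definable_ternary P ->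
  definable (fun S v => product_axioms (H0 S v) (H1 S v) (P S v)).
Proof. by move=> u0 u1 tP; rewrite /product_axioms; fo_auto. Qed.

Section ProductAxioms.
Variables (V : zmodType) (H0 H1 : V -> Prop) (P : V -> V -> V -> Prop).
Hypotheses (sgH0 : subgroup H0) (sgH1 : subgroup H1)
  (axP : product_axioms H0 H1 P).

Lemma product_axioms_uniq a c r r' : H1 a -> H1 c -> P a c r -> P a c r' ->
  H0 (r - r').
Proof.
have [tot addl _ zero _] := axP; move=> Ha Hc Pr Pr'.
have [z [_ Pz]] := tot _ _ (sg0 sgH1) Hc.
have Hz : H0 z by apply: (zero _ _ _ (sg0 sgH1) Hc Pz); left; apply: sg0.
have := addl _ _ _ _ _ _ Ha (sg0 sgH1) Hc Pr' Pz; rewrite subr0 => /(_ _ Pr) E.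
by have := sgB sgH0 E Hz; congr H0; zmod.
Qed.

Lemma product_of_axioms : exists2 mu, product_modulo H0 H1 mu &
  forall a c, H1 a -> H1 c -> P a c (mu a c).
Proof.
have [tot addl addr zero dom] := axP.
have total (ac : V * V) : exists r, H1 ac.1 -> H1 ac.2 ->
    H1 r /\ P ac.1 ac.2 r.
  case: ac => a c /=.
  have [[Ha Hc]|nH] := EM (H1 a /\ H1 c); last by exists 0 => Ha Hc; case: nH.
  by have [r rP] := tot a c Ha Hc; exists r.
have [g gP] := choice total.
have muH a c (Ha : H1 a) (Hc : H1 c) := (gP (a, c) Ha Hc).1.
have muP a c (Ha : H1 a) (Hc : H1 c) := (gP (a, c) Ha Hc).2.
exists (fun a c => g (a, c)) => //; split=> //.
- move=> z Hz y y' Hy Hy'; apply: (addl _ _ _ _ _ _ Hy Hy' Hz); apply: muP => //.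
  exact: sgB.
- move=> y Hy z z' Hz Hz'; apply: (addr _ _ _ _ _ _ Hy Hz Hz'); apply: muP => //.
  exact: sgB.
- by move=> y z Hy Hz; apply: (zero _ _ _ Hy Hz); apply: muP.
- by move=> y z Hy Hz; apply: (dom _ _ _ Hy Hz); apply: muP.
Qed.
End ProductAxioms.

(** * The order of scalar multiples of an element *)

(** Let H0 be stable under scalars, and let the scalars that map x0 into H0 form a
    prime ideal p. The scalar multiples of x0 modulo H0 are a copy of the ring of
    scalars modulo p; the product is al(x0) be(x0) = al(be(x0)). *)
Section ScalarOrder.
Variables (R : naRingType) (H0 : R -> Prop) (x0 : R).
Hypotheses (sgH0 : subgroup H0) (annH0 : forall a, annihilator a -> H0 a)
  (stableH0 : forall al, is_scalar al -> forall a, H0 a -> H0 (al a)).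

Definition scalar_multiples (a : R) : Prop :=
  exists2 al, is_scalar al & H0 (a - al x0).

Definition scalar_product (a c r : R) : Prop :=
  exists2 al, is_scalar al & H0 (a - al x0) /\ H0 (r - al c).

Lemma scalar_congr al a c : is_scalar al -> H0 (a - c) -> H0 (al a - al c).
Proof.
move=> s_al Hac; have := sgB sgH0 (stableH0 s_al Hac) (annH0 (scalarB a c s_al)).
by congr H0; zmod.
Qed.

Lemma scalar_commute al be a : is_scalar al -> is_scalar be ->
  H0 (al (be a) - be (al a)).
Proof. by move=> s_al s_be; apply: (annH0 (scalarC a s_al s_be)). Qed.

Lemma sg_scalar_multiples : subgroup scalar_multiples.
Proof.
split=> [|a c [al s_al Ha] [be s_be Hc]].
  exists (fun a => a *~ 0); first exact: (scalarMz 0 (@scalar_id R)).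
  by rewrite mulr0z subr0; apply: sg0.
exists (fun a => al a + be a *~ (-1)); first by apply/scalarD => //; apply: scalarMz.
by have := sgB sgH0 Ha Hc; congr H0; zmod.
Qed.

Lemma sub_scalar_multiples a : H0 a -> scalar_multiples a.
Proof.
move=> Ha; apply: (sg_congr sg_scalar_multiples _ (sg0 sg_scalar_multiples)).
exists (fun a => a *~ 0); first exact: (scalarMz 0 (@scalar_id R)).
by rewrite mulr0z !subr0.
Qed.

Lemma scalar_multiples_stable al : is_scalar al ->
  forall a, scalar_multiples a -> scalar_multiples (al a).
Proof.
move=> s_al a [be s_be Ha]; exists (fun z => al (be z)); first exact: scalar_comp.
exact: scalar_congr.
Qed.

Lemma scalar_multiples_gen : scalar_multiples x0.
Proof. by exists id => //; rewrite subrr; apply: sg0. Qed.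

(** The product can be computed with any scalar that represents the left factor,
    by commutativity of scalars and because c is itself a multiple of x0. *)
Lemma scalar_product_left a c r al : is_scalar al -> H0 (a - al x0) ->
  scalar_multiples c -> scalar_product a c r -> H0 (r - al c).
Proof.
move=> s_al Ha [ga s_ga Hc] [be s_be [Ha' Hr]].
apply: (sg_trans sgH0 Hr); apply: (sg_trans sgH0 (scalar_congr s_be Hc)).
apply: (sg_trans sgH0 _ (sg_sym sgH0 (scalar_congr s_al Hc))).
apply: (sg_trans sgH0 (scalar_commute x0 s_be s_ga)).
apply: (sg_trans sgH0 _ (scalar_commute x0 s_ga s_al)).
apply: (scalar_congr s_ga).
exact: (sg_trans sgH0 (sg_sym sgH0 Ha') Ha).
Qed.

Lemma scalar_product_right a c r ga : is_scalar ga -> H0 (c - ga x0) ->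
  scalar_product a c r -> H0 (r - ga a).
Proof.
move=> s_ga Hc [be s_be [Ha Hr]].
apply: (sg_trans sgH0 Hr); apply: (sg_trans sgH0 (scalar_congr s_be Hc)).
apply: (sg_trans sgH0 (scalar_commute x0 s_be s_ga)).
apply: (scalar_congr s_ga); exact: (sg_sym sgH0).
Qed.

Hypothesis x0_prime : forall al be, is_scalar al -> is_scalar be ->
  H0 (al (be x0)) -> H0 (al x0) \/ H0 (be x0).

Lemma scalar_product_axioms : product_axioms H0 scalar_multiples scalar_product.
Proof.
split.
- move=> a c [al s_al Ha] Hc; exists (al c).
  split; first exact: scalar_multiples_stable.
  by exists al => //; split=> //; rewrite subrr; apply: sg0.
- move=> a a' c r r' r'' Ha Ha' [ga s_ga Hc] P P' P''.
  have Hr := scalar_product_right s_ga Hc P.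
  have Hr' := scalar_product_right s_ga Hc P'.
  have Hr'' := scalar_product_right s_ga Hc P''.
  have := sgB sgH0 Hr'' (sgB sgH0 Hr Hr').
  by move=> /(sgD sgH0)/(_ (annH0 (scalarB a a' s_ga))); congr H0; zmod.
- move=> a c c' r r' r'' [al s_al Ha] Hc Hc' P P' P''.
  have Hr := scalar_product_left s_al Ha Hc P.
  have Hr' := scalar_product_left s_al Ha Hc' P'.
  have Hr'' := scalar_product_left s_al Ha (sgB sg_scalar_multiples Hc Hc') P''.
  have := sgB sgH0 Hr'' (sgB sgH0 Hr Hr').
  by move=> /(sgD sgH0)/(_ (annH0 (scalarB c c' s_al))); congr H0; zmod.
- move=> a c r Ha [ga s_ga Hc] P [H0a|H0c].
    by apply: (sg_congr sgH0 (scalar_product_right s_ga Hc P)); apply: stableH0.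
  case: P => al s_al [_ Hr]; apply: (sg_congr sgH0 Hr); exact: stableH0.
- move=> a c r Ha [ga s_ga Hc] [al s_al [Ha' Hr]] H0r.
  have : H0 (al (ga x0)).
    apply: (sg_congrr sgH0 _ H0r); apply: (sg_trans sgH0 Hr).
    exact: scalar_congr.
  by case/(x0_prime s_al s_ga) => Hx; [left|right]; apply: (sg_congr sgH0 _ Hx).
Qed.

Variable mu : R -> R -> R.
Hypothesis mu_prod : product_modulo H0 scalar_multiples mu.
Hypothesis muP : forall a c, scalar_multiples a -> scalar_multiples c ->
  scalar_product a c (mu a c).

Lemma scalar_productC a c : scalar_multiples a -> scalar_multiples c ->
  H0 (mu a c - mu c a).
Proof.
move=> Ha Hc; have [ga s_ga Hc'] := Hc.
apply: (sg_trans sgH0 (scalar_product_right s_ga Hc' (muP Ha Hc))).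
exact/(sg_sym sgH0)/(scalar_product_left s_ga Hc' Ha)/muP.
Qed.

Lemma scalar_productA a c r :
  scalar_multiples a -> scalar_multiples c -> scalar_multiples r ->
  H0 (mu a (mu c r) - mu (mu a c) r).
Proof.
move=> Ha Hc Hr; have [al s_al Ha'] := Ha; have [ga s_ga Hc'] := Hc.
have [mu_cl _ _ _ _] := mu_prod.
have E1 := scalar_product_left s_al Ha' (mu_cl _ _ Hc Hr) (muP Ha (mu_cl _ _ Hc Hr)).
have E2 := scalar_product_left s_ga Hc' Hr (muP Hc Hr).
have E3 := scalar_product_left s_al Ha' Hc (muP Ha Hc).
have Hac : H0 (mu a c - al (ga x0)).
  by apply: (sg_trans sgH0 E3); apply: scalar_congr.
have E4 := scalar_product_left (scalar_comp s_al s_ga) Hac Hr (muP (mu_cl _ _ Ha Hc) Hr).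
apply: (sg_trans sgH0 E1); apply: (sg_trans sgH0 (scalar_congr s_al E2)).
exact: (sg_sym sgH0).
Qed.

Lemma scalar_product1 a : scalar_multiples a -> H0 (mu x0 a - a).
Proof.
move=> Ha; apply: (scalar_product_left (@scalar_id R) _ Ha (muP _ Ha)).
  by rewrite subrr; apply: sg0.
exact: scalar_multiples_gen.
Qed.

End ScalarOrder.

Section CapturedOrder.
Variables (R : naRingType) (m : nat) (b : 'I_m -> R).
Hypothesis b_gen : forall a, exists c, a = evalc b c.
Let pt := point b_gen.

(** The formula for the multiples of x0 quantifies over codes of scalars. The
    axiom consists of the one for H0, the one for injectivity, the existence of a
    product without zero divisors whose values on the independent family are the
    right ones, and generation modulo n. *)
Lemma captured_order (H0 : R -> Prop) (x0 : R) :
  captured b H0 -> subgroup H0 -> (forall a, annihilator a -> H0 a) ->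
  (forall al, is_scalar al -> forall a, H0 a -> H0 (al a)) ->
  (forall k : int, k != 0 -> ~ H0 (x0 *~ k)) ->
  (forall al be, is_scalar al -> is_scalar be ->
     H0 (al (be x0)) -> H0 (al x0) \/ H0 (be x0)) ->
  captured b (scalar_multiples H0 x0).
Proof.
move=> [H0f [psi0 [u0 fo0 H0E psi0R ax0]]] sgH0 annH0 stable x0_free x0_prime.
set H1 := scalar_multiples H0 x0.
have sgH1 : subgroup H1 by apply: sg_scalar_multiples.
have Hx0 : H1 x0 by apply: scalar_multiples_gen.
pose H1f (S : naRingType) (x : 'I_m -> S) (y : S) := exists u : 'I_m -> S,
  code x u /\ exists y', code_act x u (pt x x0) y' /\ H0f S x (y - y').
pose Pf (S : naRingType) (x : 'I_m -> S) (a c r : S) := exists u : 'I_m -> S,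
  [/\ code x u, exists a', code_act x u (pt x x0) a' /\ H0f S x (a - a')
    & exists r', code_act x u c r' /\ H0f S x (r - r')].
have act_mod u al a a' : (forall a, code_act b u a (al a)) ->
    code_act b u a a' -> H0 (a' - al a).
  by move=> act_al act; apply/annH0/(code_act_uniq b_gen act)/act_al.
have PE a c r : Pf R b a c r <-> scalar_product H0 x0 a c r.
  split=> [[u [cu [a' [act_a /H0E Ha]] [r' [act_r /H0E Hr]]]]|[al s_al [Ha Hr]]].
    rewrite /pt point_id in act_a.
    have [al s_al act_al] := scalar_code cu; exists al => //.
    by split; [apply: (sg_trans sgH0 Ha)|apply: (sg_trans sgH0 Hr)];
       apply: (act_mod u).
  exists (fun j => al (b j)); split; first exact: (code_scalar b_gen).
    exists (al x0); split; last exact/H0E.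
    by rewrite /pt point_id; apply: code_act_scalar.
  exists (al c); split; last exact/H0E.
  exact: code_act_scalar.
have H1E a : H1f R b a <-> H1 a.
  split=> [[u [cu [a' [act_a /H0E Ha]]]]|[al s_al Ha]].
    rewrite /pt point_id in act_a.
    have [al s_al act_al] := scalar_code cu; exists al => //.
    by apply: (sg_trans sgH0 Ha); apply: (act_mod u).
  exists (fun j => al (b j)); split; first exact: (code_scalar b_gen).
  exists (al x0); split; last exact/H0E.
  by rewrite /pt point_id; apply: code_act_scalar.
have u1 : definable_unary H1f.
  by rewrite /definable_unary /H1f /code /code_act; fo_point.
have tP : definable_ternary Pf.
  by rewrite /definable_ternary /Pf /code /code_act; fo_point.
have axR := scalar_product_axioms sgH0 annH0 stable x0_prime.
have [mu mu_prod muP] := product_of_axioms sgH1 axR.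
have [s1 s1E] := subgroup_of_fg b_gen sgH1.
have [d [e [es e_free [N N0 e_gen]]]] := independent_rows s1 sgH0.
have He i : H1 (e i) by apply/s1E.
have {}e_gen a : H1 a -> exists v, H0 (a *~ N - lincomb e v).
  by move=> /s1E/e_gen.
have [mu_cl _ _ _ _] := mu_prod.
have [w wP] : {w : 'I_d * 'I_d -> 'rV[int]_d & forall ij : 'I_d * 'I_d,
    H0 (mu (e ij.1) (e ij.2) *~ N - lincomb e (w ij))}.
  by apply: (@choice _ _ (fun ij v => H0 (mu (e ij.1) (e ij.2) *~ N - lincomb e v)))
    => ij; apply/e_gen/mu_cl.
pose M i := \matrix_(j < d) w (i, j).
have table i j : H0 (mu (e i) (e j) *~ N - lincomb e (row j (M i))).
  by rewrite rowK; apply: (wP (i, j)).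
have [D D0 reduced] := order_reduced_modulo_primes sgH0 sgH1 mu_prod
  (scalar_productC sgH0 annH0 stable muP)
  (scalar_productA sgH0 annH0 stable mu_prod muP) Hx0
  (scalar_product1 sgH0 annH0 stable muP) x0_free N0 He e_free e_gen table.
(* The index must be prime to the denominator N and to the determinant D of the
   trace form; the factor 2 keeps n away from 1 and -1. *)
pose n := 2 * (N * D).
have n0 : n != 0 by rewrite !mulf_neq0.
have [ln lnH lnr] := representatives_modulo_multiple sgH1 sgH0 n0 s1E.
have sgR0 : subgroup (H0f R b).
  by split=> [|a c /H0E Ha /H0E Hc]; apply/H0E; [apply: sg0|apply: sgB].
have sgR1 : subgroup (H1f R b).
  by split=> [|a c /H1E Ha /H1E Hc]; apply/H1E; [apply: sg0|apply: sgB].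
have H01 a : H0f R b a -> H1f R b a.
  by move=> /H0E Ha; apply/H1E/sub_scalar_multiples.
have [psi1 [fo1 psi1R inj]] := injectivity_axiom b_gen u0 u1 sgR0 sgR1 H01.
pose psi (S : naRingType) (x : 'I_m -> S) :=
  [/\ psi0 S x, psi1 S x,
      subgroup (H1f S x) /\ (forall r, r \in s1 -> H1f S x (pt x r)),
      product_axioms (H0f S x) (H1f S x) (Pf S x) /\
      (forall i j, Pf S x (pt x (e i)) (pt x (e j)) (pt x (mu (e i) (e j))))
    & forall y, H1f S x y -> exists2 r, r \in ln &
        exists y', H1f S x y' /\ H0f S x (y - pt x r - y' *~ n)].
exists H1f, psi; split=> //.
- rewrite /psi; apply: fo_and5 => //.
  + apply: fo_and; first exact: fo_subgroup.
    by apply: fo_all_in => r _; fo_point.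
  + by apply: fo_and; [exact: fo_product_axioms|fo_point].
  + apply: fo_all; apply: fo_imp; first by fo_point.
    by apply: fo_ex_in => r _; fo_point.
- rewrite /psi; split=> //.
  + split=> // r rs; rewrite /pt point_id; apply/H1E/s1E; exact: span_mem.
  + have H0b : H0f R b = H0 by apply/funext => a; apply/propext; exact: H0E.
    have H1b : H1f R b = H1 by apply/funext => a; apply/propext; exact: H1E.
    have Pb : Pf R b = scalar_product H0 x0.
      by do 3!apply/funext => ?; apply/propext; exact: PE.
    by rewrite H0b H1b Pb; split=> // i j; rewrite /pt !point_id; apply: muP.
  + move=> y /H1E/lnr[r rl [h Hh Hr]]; exists r => //; exists h.
    by rewrite /pt point_id; split; [apply/H1E|apply/H0E].
move=> S f fb S_fg [ps0 ps1 [sgL1 s1L] [axS tabS] genS].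
have [sgL0 f0 sub0] := ax0 S f S_fg ps0.
have f1 a : H1 a -> H1f S fb (f a).
  by move=> /s1E; apply: span_image => // r /s1L; rewrite /pt point_hom.
have injS a : H1 a -> H0f S fb (f a) -> H0 a.
  move=> /H1E Ha Hfa; apply/H0E; apply: (inj S f) => // c; last by move=> /H1E/f1.
  by move=> /H0E/f0.
split=> // y Hy.
have [nu nu_prod nuP] := product_of_axioms sgL1 axS.
have tabnu i j : H0f S fb (nu (f (e i)) (f (e j)) *~ N - f (lincomb e (row j (M i)))).
  have Lfe k : H1f S fb (f (e k)) by apply: f1.
  have := tabS i j; rewrite /pt !point_hom => Pij.
  have E := product_axioms_uniq sgL0 sgL1 axS (Lfe i) (Lfe j) (nuP _ _ (Lfe i) (Lfe j)) Pij.
  have := sgD sgL0 (sgMz sgL0 N E) (f0 _ (table i j)).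
  by congr (H0f S fb); rewrite (raddfB f) (raddfMz f); zmod.
have [sS sSE] := S_fg.
have genS' z : H1f S fb z -> exists2 z', H1f S fb z' &
    exists2 a, H1 a & H0f S fb (z - f a - z' *~ n).
  move=> /genS[r rl [z' [Hz' Hz]]]; exists z' => //; exists r; first exact: lnH.
  by move: Hz; rewrite /pt point_hom.
have [|||a Ha Hya] := image_saturated sgH1 sgL0 sgL1 f1 f0 injS He e_free
  e_gen reduced Hx0 x0_free nu_prod tabnu sSE genS' _ _ _ Hy.
- exact: dvdz_mulr.
- by rewrite /n mulrCA dvdz_mulr.
- by rewrite /n mulrA dvdz_mull.
have [a0 Ha0 Hann] := sub0 _ Hya; exists (a + a0).
  by apply: (sgD sgH1) => //; apply: sub_scalar_multiples.
by move: Hann; congr annihilator; rewrite (raddfD f); zmod.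
Qed.
End CapturedOrder.

(** * The filtration and the sentence *)

Section Chain.
Variables (R : naRingType) (m : nat) (b : 'I_m -> R).
Hypothesis b_gen : forall a, exists c, a = evalc b c.
Let pt := point b_gen.

(** As usual for associated primes, take x with maximal annihilator, here as a
    group of codes of scalars: if be(x) is not in H, its annihilator contains that
    of x by commutativity, hence is equal to it. *)
Lemma prime_element (H : R -> Prop) : subgroup H ->
  (forall a, annihilator a -> H a) ->
  (forall al, is_scalar al -> forall a, H a -> H (al a)) ->
  (exists a, ~ H a) ->
  exists2 x, ~ H x & forall al be, is_scalar al -> is_scalar be ->
    H (al (be x)) -> H (al x) \/ H (be x).
Proof.
move=> sgH annH stable [a0 Ha0].
pose K y (u : {ffun 'I_m -> R}) := exists2 al, is_scalar al &
  (forall j, annihilator (u j - al (b j))) /\ H (al y).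
have [sR sRE] := gens_span b_gen.
have [sV sVE] := span_ffun m sRE.
have sgA := sg_annihilator R.
have [||_ [x Hx ->] max] := @subgroup_noetherian _ sV
    (fun L => exists2 y, ~ H y & L = K y).
- move=> _ [y _ ->]; split=> //; split=> [|u v [al s_al [Hu Hal]] [be s_be [Hv Hbe]]].
    exists (fun a => a *~ 0); first exact: (scalarMz 0 (@scalar_id R)).
    by split=> [j|]; rewrite ?ffunE mulr0z ?subr0; exact: sg0.
  exists (fun a => al a + be a *~ (-1)).
    by apply/scalarD => //; apply: scalarMz.
  split=> [j|]; last by rewrite mulrN1z; apply: sgB.
  by have := sgB sgA (Hu j) (Hv j); congr annihilator; rewrite !ffunE; zmod.
- by eexists; exists a0.
exists x => // al be s_al s_be Halbe.
have [Hbe|nHbe] := EM (H (be x)); [by right|left].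
have Kbe : exists2 y, ~ H y & K (be x) = K y by exists (be x).
have [||al' s_al' [eq_al Hal']] := max _ Kbe _ [ffun j => al (b j)] _.
- move=> u [ga s_ga [Hu Hga]]; exists ga => //; split=> //.
  apply: (sg_congr sgH (annH _ (scalarC x s_ga s_be))); exact: stable.
- by exists al => //; split=> // j; rewrite ffunE subrr; apply: sg0.
(* The scalars al and al' agree on the generators, hence everywhere. *)
apply: (sg_congr sgH _ Hal'); apply: annH.
pose E a := annihilator (al a - al' a).
have sgE : subgroup E.
  have E0 (ga : R -> R) : is_scalar ga -> annihilator (ga 0).
    by move=> s_ga; have := scalarB 0 0 s_ga; rewrite !subrr subr0.
  split=> [|c d Ec Ed]; first exact: (sgB sgA (E0 _ s_al) (E0 _ s_al')).
  have := sgD sgA (scalarB c d s_al) (sgB sgA (sgB sgA Ec Ed) (scalarB c d s_al')).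
  by congr annihilator; zmod.
apply: (gen_induction b_gen sgE) => j.
by have := eq_al j; rewrite ffunE.
Qed.

(** A maximal captured subgroup that is stable under scalars is everything, since
    otherwise the multiples of a prime element can be added to it. *)
Lemma captured_all : captured b (fun _ => True).
Proof.
have [sR sRE] := gens_span b_gen.
pose F H := [/\ captured b H, subgroup H, forall a, annihilator a -> H a &
  forall al, is_scalar al -> forall a, H a -> H (al a)].
have [||H [capH sgH annH stable] max] := @subgroup_noetherian _ sR F.
- by move=> H [].
- exists (@annihilator R); split=> //.
  + exact: captured_annihilator.
  + exact: sg_annihilator.
  + move=> al [al1 _] a Ha c.
    by split; [rewrite al1 (Ha _).1|rewrite -al1 (Ha _).2].
suff allH a : H a.
  suff -> : (fun _ => True) = H by [].
  by apply/funext => a; apply/propext; split.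
apply: contrapT => Ha.
have [x Hx prime_x] := prime_element sgH annH stable (ex_intro _ a Ha).
pose H1 := scalar_multiples H x.
have sgH1 : subgroup H1 by apply: sg_scalar_multiples.
have H01 c : H c -> H1 c by apply: sub_scalar_multiples.
have capH1 : captured b H1.
  have [[k [k0 Hk]]|free_x] := EM (exists k : int, k != 0 /\ H (x *~ k)); last first.
    by apply: captured_order => // k k0 Hk; apply: free_x; exists k.
  have [s sE] := subgroup_of_fg b_gen sgH1.
  have [|l ls lr] := @finite_representatives _ s H sgH.
    move=> c /span_mem/sE[al s_al Hc]; exists k => //.
    have sgT : subgroup (fun _ : R => True) by [].
    have A := moduloMz sgT (sg_annihilator R)
      (fun c d _ _ => scalarB c d s_al) k (I : (fun=> True) x).
    apply: (sg_congr sgH (sg_subMz sgH k Hc)).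
    by apply: (sg_congrr sgH (annH _ A)); apply: stable.
  apply: (captured_finite b_gen capH sgH sgH1 H01 (l := l)) => [r /ls/sE //|c /sE/lr //].
have FH1 : F H1.
  split=> // [c /annH/H01 //|]; exact: scalar_multiples_stable.
by apply: Hx; apply: (max _ FH1 H01); apply: scalar_multiples_gen.
Qed.

Lemma hom_of_relations (S : naRingType) (x : 'I_m -> S) :
  (forall c, evalc b c = 0 -> evalc x c = 0) ->
  (forall i j, x i ** x j = pt x (b i ** b j)) ->
  exists f : {additive R -> S},
    (forall i, f (b i) = x i) /\ forall a c, f (a ** c) = f a ** f c.
Proof.
move=> rel tab.
have evE c a : evalc b c = a -> pt x a = evalc x c.
  move=> ca; apply/eqP; rewrite -subr_eq0 -evalcB; apply/eqP/rel.
  by rewrite evalcB coordE ca subrr.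
have ptB : zmod_morphism (pt x).
  move=> a c; rewrite (evE (coord b_gen a - coord b_gen c)) ?evalcB //.
  by rewrite !coordE.
pose f : {additive R -> S} :=
  HB.pack (pt x) (GRing.isZmodMorphism.Build R S (pt x) ptB).
have fb i : f (b i) = x i.
  have delta T (z : 'I_m -> T : zmodType) : \sum_j z j *~ (j == i)%:R = z i.
    by rewrite (bigD1 i) //= eqxx mulr1z big1 ?addr0 // => j /negPf ->.
  rewrite /f /= (evE [ffun j => (j == i)%:R]) /evalc.
    by rewrite -[RHS]delta; apply: eq_bigr => j _; rewrite ffunE.
  by rewrite -[RHS]delta; apply: eq_bigr => j _; rewrite ffunE.
exists f; split=> // a c; move: a; apply: (gen_induction b_gen) => [|i].
  split=> [|a a' Ea Ea'].
    by rewrite namul0r (raddf0 f) namul0r.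
  by rewrite namulBl !(raddfB f) Ea Ea' namulBl.
move: c; apply: (gen_induction b_gen) => [|j].
  split=> [|a a' Ea Ea'].
    by rewrite namulr0 (raddf0 f) namulr0.
  by rewrite namulBr !(raddfB f) Ea Ea' namulBr.
by rewrite !fb tab.
Qed.

(** The sums of the b_j y_j form an ideal, because a product a c is expanded along
    its left factor; so this is the square of R, and a sum of products never needs
    more than m terms. Tameness says that Ann(R) is torsion modulo it. *)
Lemma tame_representatives : tame R -> exists l : seq R, forall z, annihilator z ->
  exists2 t, t \in l & exists y y' : 'I_m -> R, z = t + \sum_j y j ** y' j.
Proof.
move=> tR; pose Q z := exists y : 'I_m -> R, z = \sum_j b j ** y j.
have sgQ : subgroup Q.
  split=> [|z z' [y ->] [y' ->]].
    by exists (fun _ => 0); rewrite big1 // => j _; rewrite namulr0.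
  exists (fun j => y j - y' j); rewrite -sumrB.
  by apply: eq_bigr => j _; rewrite namulBr.
have Qmul a c : Q (a ** c).
  have [d ->] := b_gen a; exists (fun j => c *~ d j); rewrite namul_suml.
  by apply: eq_bigr => j _; rewrite namulMzl namulMzr.
have [s sE] := subgroup_of_fg b_gen (sg_annihilator R).
have [|l _ lr] := @finite_representatives _ s Q sgQ.
  move=> a /span_mem/sE/tR[k k0 sq]; exists k => //; apply: sq.
    split=> //; [exact: sg0|exact: (sgB sgQ)].
  by move=> _ [y [z ->]].
exists l => z /sE/lr[t tl [y Hy]]; exists t => //; exists b, y.
by rewrite -Hy addrC subrK.
Qed.

End Chain.

Lemma na_isomorphic_of_bijection (R S : naRingType) (f : {additive R -> S}) :
  (forall a c, f (a ** c) = f a ** f c) -> injective f ->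
  (forall y, exists a, y = f a) -> na_isomorphic S R.
Proof.
move=> fM f_inj /choice[g gP].
have fK : cancel g f by move=> y; rewrite -gP.
have gK : cancel f g by move=> a; apply: f_inj; rewrite fK.
have gB : zmod_morphism g by move=> x y; apply: f_inj; rewrite raddfB !fK.
pose h : {additive S -> R} := HB.pack g (GRing.isZmodMorphism.Build S R g gB).
exists h; split; first by exists f.
by move=> x y; apply: f_inj; rewrite fM !fK.
Qed.

Lemma sat_isomorphic (S R : naRingType) (f : {additive S -> R}) :
  bijective f -> (forall x y, f (x ** y) = f x ** f y) ->
  forall phi e, sat e phi <-> sat (fun n => f (e n)) phi.
Proof.
move=> [g fK gK] fM.
have f_inj := can_inj fK.
have evalE e t : eval (fun n => f (e n)) t = f (eval e t).
  elim: t => [n||s IHs t IHt|s IHs t IHt] //=; rewrite ?raddf0 //.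
    by rewrite IHs IHt raddfD.
  by rewrite IHs IHt fM.
have upd e n y phi : sat [eta (fun k => f (e k)) with n |-> f y] phi <->
    sat (fun k => f ([eta e with n |-> y] k)) phi.
  by apply: sat_ext => k /=; case: eqP.
elim=> [t1 t2|p IH|p IHp q IHq|p IHp q IHq|p IHp q IHq|n p IH|n p IH] e /=.
- by rewrite !evalE; split=> [->|/f_inj].
- by rewrite (IH e).
- by rewrite (IHp e) (IHq e).
- by rewrite (IHp e) (IHq e).
- by rewrite (IHp e) (IHq e).
- split=> H x; first by rewrite -(gK x); apply/upd/IH.
  by apply/IH/upd.
- split=> -[x Hx]; first by exists (f x); apply/upd/IH.
  by exists (g x); apply/IH/upd; rewrite gK.
Qed.

Theorem theorem1p7 (R : naRingType) (hR : fdz_algebra R) (tR : tame R) :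
  exists phi : formula,
    [/\ sentence phi,
        models R phi
      & forall S : naRingType, fdz_algebra S ->
          (models S phi <-> na_isomorphic S R)].
Proof.
have fdz_span (S : naRingType) : fdz_algebra S -> exists s, forall y : S, span s y.
  move=> [k [s gen]]; exists s => y; have [a ->] := gen y.
  apply: (sg_sum (sg_span s)) => i; apply: (sgMz (sg_span s)).
  by apply/span_mem/mem_nth; rewrite size_tuple.
have [m [s gen]] := hR.
pose b i := tnth s i.
have b_gen a : exists c, a = evalc b c.
  have [c ->] := gen a; exists [ffun i => c i]; apply: eq_bigr => i _.
  by rewrite ffunE /b (tnth_nth 0).
pose pt := point b_gen.
have [Hf [psi [uH fo_psi HfE psiR capS]]] := captured_all b_gen.
have [l lR] := tame_representatives b_gen tR.
pose whole (S : naRingType) (_ : 'I_m -> S) (_ : S) := True.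
pose zero (S : naRingType) (_ : 'I_m -> S) (y : S) := y = 0.
have sgZ (S : naRingType) : subgroup (fun y : S => y = 0).
  by split=> // x y -> ->; rewrite subr0.
have u_zero : definable_unary zero by rewrite /definable_unary /zero; fo_auto.
have u_whole : definable_unary whole by exact: fo_const.
have sg_whole : subgroup (whole R b) by [].
have [psi1 [fo1 psi1R inj]] := injectivity_axiom b_gen u_zero u_whole (sgZ R)
  sg_whole (fun _ _ => I).
have [sI sIE] : exists s : seq int, forall k, span s k.
  by exists [:: 1] => k; exists k; rewrite /= intz subrr.
have [sV sVE] := span_ffun m sIE.
have sgrel (S : naRingType) (x : 'I_m -> S) : subgroup (fun c => evalc x c = 0).
  split=> [|c d Ec Ed]; last by rewrite evalcB Ec Ed subr0.
  by rewrite /evalc big1 // => i _; rewrite ffunE.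
have [rels relsE] := subgroup_fg (sgrel R b) (fun c _ => sVE c).
(* In order: the additive relations and the multiplication table of the
   generators; S = f(R) + Ann(S); injectivity; Ann(S) lies in finitely many cosets
   of the sums of m products. *)
pose Phi (S : naRingType) (x : 'I_m -> S) :=
  [/\ forall c, c \in rels -> evalc x c = 0,
      forall i j, x i ** x j = pt S x (b i ** b j),
      psi S x /\ (forall y, Hf S x y), psi1 S x
    & forall z, annihilator z -> exists2 t, t \in l &
        exists y y' : 'I_m -> S, z = pt S x t + \sum_j y j ** y' j].
have fo_Phi : definable Phi.
  have uA := @unary_annihilator 'I_m.
  apply: fo_and5 => //.
  - by apply: fo_all_in => c _; apply: fo_eq; [exact: (fe_evalc id)|fo_auto].
  - apply: fo_all_fin => i; apply: fo_all_fin => j.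
    by apply: fo_eq; [fo_auto|exact: (fe_point b_gen id)].
  - by fo_auto.
  - apply: fo_all; apply: fo_imp.
      by apply: (fo_unary Some uA); fo_auto.
    apply: fo_ex_in => t _; repeat first [apply: fe_point | fo_step].
have fo_ex_Phi : definable (fun (S : naRingType) (_ : void -> S) => exists x, Phi S x).
  exact: fo_ex_block (fo_rename inr fo_Phi).
have [phi [fv sat_phi]] := fo_ex_Phi 0%N (of_void _) (fun i => match i with end).
have phiE (S : naRingType) (e : nat -> S) : sat e phi <-> exists x, Phi S x.
  by apply: (sat_phi S e (of_void _)); case.
have phiR : models R phi.
  move=> e; apply/phiE; exists b; split=> //.
  - by move=> c /span_mem/relsE.
  - by move=> i j; rewrite /pt point_id.
  - by split=> // y; apply/HfE.
  - move=> z /lR[t tl [y [y' ->]]]; exists t => //; exists y, y'.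
    by rewrite /pt point_id.
exists phi; split=> //.
  rewrite /sentence; case: (free_vars phi) fv => // j f /(_ j (mem_head _ _)).
  by case=> -[].
move=> S hS; split=> [modS|[f [f_bij fM]] e]; last first.
  by apply/(sat_isomorphic f_bij fM); apply: phiR.
have [x [rel tab [ps all_H] ps1 tame_ax]] := (phiE S (fun=> 0)).1 (modS _).
have [|f [fb fM]] := hom_of_relations _ tab.
  by move=> c /relsE; apply: (span_min (sgrel S x) rel).
have xE : x = fun i => f (b i) by apply/funext => i; rewrite fb.
rewrite xE in ps all_H ps1 tame_ax.
have [_ _ gen_ann] := capS S f (fdz_span S hS) ps.
have prod_image y y' : exists a, y ** y' = f a.
  have [a _ Ha] := gen_ann y (all_H y); have [c _ Hc] := gen_ann y' (all_H y').
  exists (a ** c); rewrite fM.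
  by rewrite (annihilator_eqr y' Ha).1 (annihilator_eqr (f a) Hc).2.
have f_surj y : exists a, y = f a.
  have [a _ /tame_ax[t _ [z [z' Hz]]]] := gen_ann y (all_H y).
  have [c cP] := choice (fun j => prod_image (z j) (z' j)).
  exists (a + (t + \sum_j c j)); rewrite !(raddfD f) (raddf_sum f).
  rewrite -[LHS](subrK (f a)) Hz /pt point_hom addrC; congr (_ + (_ + _)).
  exact: eq_bigr.
apply: (na_isomorphic_of_bijection fM _ f_surj) => a c fac.
apply/eqP; rewrite -subr_eq0; apply/eqP.
apply: (inj S f ps1 (sgZ S) _ (fun _ _ => I) _ I).
  by move=> z ->; rewrite /zero (raddf0 f).
by rewrite /zero (raddfB f) fac subrr.
Qed.
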